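(* Suppose $\boldsymbol{X}=\boldsymbol{X}^{(N)}\in[q]^N$ is a sample from the Potts model $\mathbb{P}_{\beta,\boldsymbol{B}}$ with coupling matrix $\boldsymbol{A}_N$ with non-negative entries, where $\gamma:=\sup_{N\ge1}\max_{i\in[N]}\sum_{j=1}^N a_{ij}<\infty$ and $\liminf_{N\to\infty}\frac1N\sum_{1\le i,j\le N}a_{ij}>0$. Let $(\beta,\boldsymbol{B})\in\Theta:=(0,\infty)\times\mathbb{R}^{q-1}$. Then: (a) The MPL estimator $(\hat\beta_N,\hat{\boldsymbol{B}}_N)$ exists if $\boldsymbol{X}\in\Omega_N\cap\Lambda_N$, where $$\Lambda_N:=\{\boldsymbol{y}\in[q]^N:\ \text{for every } r\in[q]\text{ there exists } i\in[N]\text{ such that } y_i=r\},$$ and $\Omega_N$ is the set of all $\boldsymbol{y}\in[q]^N$ for which there exist $1\le r<s\le q$ and pairwise distinct indices $i,j,k,\ell\in[N]$ such that $\{y_i,y_j\}=\{r,s\}=\{y_k,y_\ell\}$ and $$\max\{\widetilde m_i^{r,s}(\boldsymbol{y}),\widetilde m_j^{r,s}(\boldsymbol{y})\}<\min\{\widetilde m_k^{r,s}(\boldsymbol{y}),\widetilde m_\ell^{r,s}(\boldsymbol{y})\},\qquad \widetilde m_u^{r,s}(\boldsymbol{y}):=m_{u,r}(\boldsymbol{y})-m_{u,s}(\boldsymbol{y}).$$ (b) If $T_N(\boldsymbol{X})^{-1}=o_{\mathbb{P}}(\sqrt N)$ and the MPL estimator exists (with probability tending to $1$), then $$\|(\hat\beta_N-\beta,\hat{\boldsymbol{B}}_N-\boldsymbol{B})\|_2=O_{\mathbb{P}}\left(\frac{1}{\sqrt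 N\,T_N(\boldsymbol{X})}\right).$$ (c) In particular, if $T_N(\boldsymbol{X})^{-1}=O_{\mathbb{P}}(1)$, then $\mathbb{P}_{\beta,\boldsymbol{B}}(\boldsymbol{X}\in\Omega_N\cap\Lambda_N)\to1$ as $N\to\infty$. Consequently, the MPL estimator $(\hat\beta_N,\hat{\boldsymbol{B}}_N)$ exists with probability tending to $1$, and satisfies $$\|(\hat\beta_N-\beta,\hat{\boldsymbol{B}}_N-\boldsymbol{B})\|_2=O_{\mathbb{P}}\left(\frac{1}{\sqrt N}\right).$$
   Context: Fix an integer $q\ge2$ and write $[m]=\{1,\dots,m\}$. For each $N$, $\boldsymbol{A}_N=((a_{ij}))_{1\le i,j\le N}$ is a known deterministic symmetric matrix with zero diagonal and non-negative entries. For $\beta>0$ and $\boldsymbol{B}=(B_1,\dots,B_{q-1})\in\mathbb{R}^{q-1}$, with the convention $B_q:=0$, the Potts model is the probability mass function on $[q]^N$ $$\mathbb{P}_{\beta,\boldsymbol{B}}(\boldsymbol{x})=\frac{1}{Z_N(\beta,\boldsymbol{B})}\exp\Big(\frac\beta2\sum_{1\le i,j\le N}a_{ij}\mathbf 1_{x_i=x_j}+\sum_{i=1}^N\sum_{r=1}^qB_r\mathbf 1_{x_i=r}\Big),$$ where $Z_N(\beta,\boldsymbol{B})$ is the normalizing constant. For $\boldsymbol{x}\in[q]^N$ let $m_{i,r}(\boldsymbol{x}):=\sum_{j=1}^Na_{ij}\mathbf 1_{x_j=r}$ and $\overline m_r(\boldsymbol{x}):=\frac1N\sum_{i=1}^Nm_{i,r}(\boldsymbol{x})$,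 and $$T_N(\boldsymbol{x}):=\sum_{1\le r<s\le q}\Big(\frac1N\sum_{i=1}^N(m_{i,r}(\boldsymbol{x})-m_{i,s}(\boldsymbol{x}))^2-(\overline m_r(\boldsymbol{x})-\overline m_s(\boldsymbol{x}))^2\Big).$$ The log pseudo-likelihood is, for $(\beta,\boldsymbol{B})\in\mathbb{R}^q$ (with $B_q:=0$), $$\ell_N(\beta,\boldsymbol{B}):=\beta\sum_{i=1}^N\sum_{r=1}^qm_{i,r}(\boldsymbol{X})\mathbf 1_{X_i=r}+\sum_{i=1}^N\sum_{r=1}^qB_r\mathbf 1_{X_i=r}-\sum_{i=1}^N\log\Big(\sum_{r=1}^q\exp\{\beta m_{i,r}(\boldsymbol{X})+B_r\}\Big).$$ The maximum pseudo-likelihood (MPL) estimator $(\hat\beta_N,\hat{\boldsymbol{B}}_N)$ is the unique maximizer of $\ell_N$ over $\mathbb{R}^q$; it is said to exist if $\ell_N$ has a unique maximizer over $\mathbb{R}^q$ (where it does not exist it may be assigned an arbitrary value). Symbols $O_{\mathbb{P}},o_{\mathbb{P}}$ are as $N\to\infty$ under the true law $\mathbb{P}_{\beta,\boldsymbol{B}}$; for positive random sequences, $Y_N=O_{\mathbb{P}}(W_N)$ means $Y_N/W_N$ is tight; $1/0:=\infty$. *)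

(* Defs.v *)
From HB Require Import structures.
From mathcomp Require Import all_boot all_order all_algebra.
From mathcomp Require Import all_classical all_reals all_analysis.

Set Implicit Arguments.
Unset Strict Implicit.
Unset Printing Implicit Defensive.

Import Order.TTheory GRing.Theory Num.Theory.
Import numFieldNormedType.Exports.

Local Open Scope classical_set_scope.
Local Open Scope ring_scope.

(* The colour r in {1, ..., q} is represented by r - 1 in 'I_q. *)
Notation config q N := {ffun 'I_N -> 'I_q}.

(* (beta, B) in R^q, with beta in R and B = (B_1, ..., B_(q-1)). *)
Notation param R q := (R * 'rV[R]_(q.-1))%type.

Section Potts.
Context {R : realType} {q : nat}.

(* The convention B_q = 0: the last colour is the only one whose value is not
   an element of 'I_(q.-1). *)
Definition ext_field (B : 'rV[R]_(q.-1)) (r : 'I_q) : R :=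
  if insub (val r) is Some r' then B ord0 r' else 0.

Definition potts_weight (N : nat) (A : 'M[R]_N) (theta : param R q)
    (x : config q N) : R :=
  expR (theta.1 / 2 * (\sum_(i < N) \sum_(j < N) A i j * (x i == x j)%:R)
        + \sum_(i < N) \sum_(r < q) ext_field theta.2 r * (x i == r)%:R).

Definition potts_Z (N : nat) (A : 'M[R]_N) (theta : param R q) : R :=
  \sum_(x : config q N) potts_weight A theta x.

Definition potts_pmf (N : nat) (A : 'M[R]_N) (theta : param R q)
    (x : config q N) : R :=
  potts_weight A theta x / potts_Z A theta.

Definition potts_prob (N : nat) (A : 'M[R]_N) (theta : param R q)
    (E : set (config q N)) : R :=
  \sum_(x : config q N | x \in E) potts_pmf A theta x.

Definition local_field (N : nat) (A : 'M[R]_N) (x : config q N)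
    (i : 'I_N) (r : 'I_q) : R :=
  \sum_(j < N) A i j * (x j == r)%:R.

Definition mean_local_field (N : nat) (A : 'M[R]_N) (x : config q N)
    (r : 'I_q) : R :=
  N%:R^-1 * \sum_(i < N) local_field A x i r.

Definition T_stat (N : nat) (A : 'M[R]_N) (x : config q N) : R :=
  \sum_(r < q) \sum_(s < q | (r < s)%N)
    (N%:R^-1 * (\sum_(i < N) (local_field A x i r - local_field A x i s) ^+ 2)
     - (mean_local_field A x r - mean_local_field A x s) ^+ 2).

(* Inversion in \bar R is such that 0^-1 = +oo. *)
Definition T_inv (N : nat) (A : 'M[R]_N) (x : config q N) : \bar R :=
  ((T_stat A x)%:E^-1)%E.

Definition log_pseudolik (N : nat) (A : 'M[R]_N) (x : config q N)
    (theta : param R q) : R :=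
  theta.1 * (\sum_(i < N) \sum_(r < q) local_field A x i r * (x i == r)%:R)
  + \sum_(i < N) \sum_(r < q) ext_field theta.2 r * (x i == r)%:R
  - \sum_(i < N)
      ln (\sum_(r < q) expR (theta.1 * local_field A x i r + ext_field theta.2 r)).

Definition maximizes_pseudolik (N : nat) (A : 'M[R]_N) (x : config q N)
    (theta : param R q) : Prop :=
  forall theta' : param R q, log_pseudolik A x theta' <= log_pseudolik A x theta.

Definition MPL_exists (N : nat) (A : 'M[R]_N) (x : config q N) : Prop :=
  exists! theta : param R q, maximizes_pseudolik A x theta.

(* Nothing is required of the estimator where the unique maximizer fails to
   exist. *)
Definition is_MPL_estimator (A : forall N, 'M[R]_N)
    (thetahat : forall N, config q N -> param R q) : Prop :=
  forall (N : nat) (x : config q N),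
    MPL_exists (A N) x -> maximizes_pseudolik (A N) x (thetahat N x).

(* The norm provided by the library on matrices and pairs is the sup norm. *)
Definition l2_dist (theta theta' : param R q) : R :=
  Num.sqrt ((theta.1 - theta'.1) ^+ 2
            + \sum_(r < q.-1) (theta.2 ord0 r - theta'.2 ord0 r) ^+ 2).

Definition Lambda_set (N : nat) : set (config q N) :=
  [set y : config q N | forall r : 'I_q, exists i : 'I_N, y i = r].

Definition field_gap (N : nat) (A : 'M[R]_N) (y : config q N)
    (r s : 'I_q) (u : 'I_N) : R :=
  local_field A y u r - local_field A y u s.

Definition Omega_set (N : nat) (A : 'M[R]_N) : set (config q N) :=
  [set y : config q N | exists (r s : 'I_q) (i j k l : 'I_N),
    [/\ (r < s)%N, uniq [:: i; j; k; l],
        [set y i; y j]%SET = [set r; s]%SET,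
        [set r; s]%SET = [set y k; y l]%SET &
        Num.max (field_gap A y r s i) (field_gap A y r s j)
          < Num.min (field_gap A y r s k) (field_gap A y r s l)]].

(* Stochastic order symbols, as N goes to infinity, for sequences of random
   variables Y N and W N defined on configurations, under the laws P N.  The
   variables take values in \bar R because 1 / T_N may be infinite with positive
   probability for every N; hence tightness is required eventually in N
   (for finite variables this is the same as tightness of the whole sequence).
   A ratio with infinite denominator is 0 when its numerator is finite. *)
Definition bigO_P (P : forall N, set (config q N) -> R)
    (Y W : forall N, config q N -> \bar R) : Prop :=
  forall eps : R, 0 < eps -> exists K : R,
    \forall N \near \oo, P N [set x | K%:E < `|Y N x / W N x|]%E <= eps.

Definition littleo_P (P : forall N, set (config q N) -> R)
    (Y W : forall N, config q N -> \bar R) : Prop :=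
  forall eps : R, 0 < eps ->
    P N [set x | eps%:E < `|Y N x / W N x|]%E @[N --> \oo] --> (0 : R).

End Potts.
Arguments Lambda_set {q} N.

(* Main.v *)
(* Given the other spins, the residual 1_{X_i = r} - p_{i,r} has mean zero, and any
   statistic of spin j that is Lipschitz with respect to the coupling moves by O(a_ij)
   when spin i is resampled.  Hence every sum over i of h_i (1_{X_i = r} - p_{i,r}),
   with h bounded and Lipschitz, has second moment O(N).
   With h = 1 and h = m_{i,r} this bounds the score at the true parameter by
   O_P(sqrt N), while the curvature of the concave function l_N near it is at least a
   constant times N T_N; comparing the two along the segment to the maximizer gives (b).
   For (a), membership in Omega_N and Lambda_N makes the superlevel sets of l_N
   bounded and the quadratic form of the curvature definite.
   For (c), if X lies in Lambda_N but not in Omega_N, then for each pair (r, s) either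
   the gaps are constant on one of the two colours or a threshold t separates them.
   Sums with h a polynomial in the gaps, possibly times p_{i,s}, then show that
   N T_N = O_P(sqrt N); the threshold is random, but it enters only polynomially. *)

Require Import Defs.
From HB Require Import structures.
From mathcomp Require Import all_boot all_order all_algebra.
From mathcomp Require Import all_classical all_reals all_analysis.
From mathcomp Require Import ring lra.

Set Implicit Arguments.
Unset Strict Implicit.
Unset Printing Implicit Defensive.

Import Order.TTheory GRing.Theory Num.Theory.
Import numFieldNormedType.Exports.

Local Open Scope classical_set_scope.
Local Open Scope ring_scope.

(** * Log-moment inequalities *)

Section LogMoment.
Context {R : realType}.

(** The tangent bound [1 + y <= expR y], based at the intermediate point [s * z], is applied towards
    both endpoints [z] and [0]; with weights [s] and [1 - s] the first-order terms cancel. *)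
Lemma expR_interp (s z : R) : 0 <= s <= 1 -> expR (s * z) <= s * expR z + (1 - s).
Proof.
move=> /andP[s0 s1].
have e0 : 0 <= expR (s * z) by exact: expR_ge0.
have h1 : expR (s * z) * (1 + (1 - s) * z) <= expR z.
  have -> : expR z = expR (s * z) * expR ((1 - s) * z).
    by rewrite -expRD; congr expR; ring.
  by apply: ler_wpM2l => //; exact: expR_ge1Dx.
have h2 : expR (s * z) * (1 - s * z) <= 1.
  rewrite [leRHS](_ : _ = expR (s * z) * expR (- (s * z))); last first.
    by rewrite -expRD subrr expR0.
  by apply: ler_wpM2l => //; exact: expR_ge1Dx.
have h3 := ler_wpM2l s0 h1.
have h4 : (1 - s) * (expR (s * z) * (1 - s * z)) <= (1 - s) * 1.
  by apply: ler_wpM2l => //; lra.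
rewrite [leLHS](_ : _ = s * (expR (s * z) * (1 + (1 - s) * z))
   + (1 - s) * (expR (s * z) * (1 - s * z))); first lra.
by ring.
Qed.

(* [expR y = expR (y / 2) ^+ 2], and [1 + y / 2] is nonnegative. *)
Lemma expR_ge_quad (y : R) : -2 <= y -> 1 + y + y ^+ 2 / 4 <= expR y.
Proof.
move=> y2; have h : 1 + y / 2 <= expR (y / 2) by exact: expR_ge1Dx.
have -> : expR y = expR (y / 2) ^+ 2.
  by rewrite expr2 -expRD; congr expR; field.
have -> : 1 + y + y ^+ 2 / 4 = (1 + y / 2) ^+ 2 by field.
by rewrite lerXn2r ?nnegrE ?expR_ge0 //; lra.
Qed.

Lemma ln1D_ge (z : R) : 0 <= z -> z / (1 + z) <= ln (1 + z).
Proof.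
move=> z0; have z1 : 0 < 1 + z by lra.
have h : ln (1 + z)^-1 <= (1 + z)^-1 - 1.
  rewrite -[X in ln X](_ : 1 + ((1 + z)^-1 - 1) = _); last by ring.
  apply: le_ln1Dx; have : 0 < (1 + z)^-1 by rewrite invr_gt0.
  lra.
rewrite lnV ?posrE // in h.
have -> : z / (1 + z) = 1 - (1 + z)^-1 by field; rewrite gt_eqF.
lra.
Qed.

Context (I : finType) (p : I -> R).
Context (p_gt0 : forall i, 0 < p i) (p_sum1 : \sum_i p i = 1).
Implicit Type h : I -> R.

Let wmean h := \sum_i p i * h i.
Let wvar h := \sum_i p i * (h i - wmean h) ^+ 2.

Lemma mgf_gt0 h : 0 < \sum_i p i * expR (h i).
Proof.
have [i0|noI] := pickP I; last first.
  by move: p_sum1; rewrite big_pred0 // => /esym/eqP; rewrite oner_eq0.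
rewrite (bigD1 i0) //= ltr_pwDl ?mulr_gt0 ?expR_gt0 //.
by apply: sumr_ge0 => i _; rewrite mulr_ge0 ?expR_ge0 // ltW.
Qed.

(** After centring by [wmean h] the exponents lie in [[-2, 2]], so [expR_ge_quad] bounds the
    remaining sum below by [1 + v / 4] with [v = wvar h]. The 5 comes from
    [ln (1 + v / 4) >= v / (4 + v)] together with [v <= 1]. *)
Lemma log_mgf_quad h : (forall i, `|h i| <= 1) ->
  wmean h + wvar h / 5 <= ln (\sum_i p i * expR (h i)).
Proof.
move=> h1.
have mu1 : `|wmean h| <= 1.
  apply: le_trans (ler_norm_sum _ _ _) _; rewrite -[leRHS]p_sum1.
  apply: ler_sum => i _; rewrite normrM (gtr0_norm (p_gt0 i)).
  by rewrite -[leRHS]mulr1 ler_wpM2l // ltW.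
have dev i : `|h i - wmean h| <= 2.
  by apply: le_trans (ler_normB _ _) _; move: (h1 i) mu1; lra.
have v0 : 0 <= wvar h.
  by apply: sumr_ge0 => i _; rewrite mulr_ge0 ?sqr_ge0 // ltW.
have v1 : wvar h <= 1.
  have -> : wvar h = \sum_i p i * h i ^+ 2 - wmean h ^+ 2.
    rewrite /wvar (eq_bigr (fun i => p i * h i ^+ 2
       - 2 * wmean h * (p i * h i) + wmean h ^+ 2 * p i)); last by move=> *; ring.
    by rewrite big_split sumrB /= -!mulr_sumr p_sum1 -/(wmean h); ring.
  suff : \sum_i p i * h i ^+ 2 <= 1 by have := sqr_ge0 (wmean h); lra.
  rewrite -[leRHS]p_sum1; apply: ler_sum => i _.
  rewrite -[leRHS]mulr1 ler_wpM2l //; first exact: ltW.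
  by rewrite -real_normK ?num_real // exprn_ile1.
have -> : \sum_i p i * expR (h i)
    = expR (wmean h) * \sum_i p i * expR (h i - wmean h).
  rewrite mulr_sumr; apply: eq_bigr => i _.
  by rewrite mulrCA -expRD; congr (_ * expR _); ring.
rewrite lnM ?posrE ?expR_gt0 ?(mgf_gt0 (fun i => h i - wmean h)) // expRK lerD2l.
have low : 1 + wvar h / 4 <= \sum_i p i * expR (h i - wmean h).
  apply: (@le_trans _ _ (\sum_i p i *
      (1 + (h i - wmean h) + (h i - wmean h) ^+ 2 / 4))); last first.
    apply: ler_sum => i _; apply: ler_wpM2l; first exact: ltW.
    by apply: expR_ge_quad; have := dev i; rewrite ler_norml => /andP[].
  rewrite (eq_bigr (fun i => (1 - wmean h) * p i + p i * h i
     + p i * (h i - wmean h) ^+ 2 / 4)); last by move=> *; field.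
  rewrite !big_split /= -mulr_suml -mulr_sumr p_sum1 -/(wvar h) -/(wmean h).
  by lra.
apply: (@le_trans _ _ (ln (1 + wvar h / 4))); last first.
  by rewrite ler_ln ?posrE //; [lra|exact: mgf_gt0].
apply: le_trans (ln1D_ge _); last by lra.
have -> : wvar h / 4 / (1 + wvar h / 4) = wvar h / (4 + wvar h).
  by field; rewrite gt_eqF //; lra.
by apply: ler_wpM2l => //; rewrite lef_pV2 ?posrE; lra.
Qed.

(** Convexity of the cumulant generating function, which vanishes at 0. Subtracting [L] from [h]
    normalizes the moment generating function to 1, after which [expR_interp] is averaged over
    [i]. *)
Lemma log_mgf_scale h (s : R) : 0 <= s <= 1 ->
  ln (\sum_i p i * expR (s * h i)) <= s * ln (\sum_i p i * expR (h i)).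
Proof.
move=> s01; set L := ln (\sum_i p i * expR (h i)).
have EL : expR L = \sum_i p i * expR (h i).
  by apply: lnK; rewrite posrE mgf_gt0.
rewrite -[leRHS]expRK ler_ln ?posrE ?expR_gt0 ?mgf_gt0 //.
have -> : \sum_i p i * expR (s * h i)
    = expR (s * L) * \sum_i p i * expR (s * (h i - L)).
  rewrite mulr_sumr; apply: eq_bigr => i _.
  by rewrite mulrCA -expRD; congr (_ * expR _); ring.
rewrite -[leRHS]mulr1 ler_wpM2l ?expR_ge0 //.
apply: (@le_trans _ _ (\sum_i (s * expR (- L) * (p i * expR (h i)) + (1 - s) * p i))).
  apply: ler_sum => i _.
  have := ler_wpM2l (ltW (p_gt0 i)) (expR_interp (h i - L) s01).
  by rewrite expRD; lra.
by rewrite big_split /= -!mulr_sumr p_sum1 -EL -mulrA -expRD addNr expR0; lra.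
Qed.

(** Only the terms [i] and [j] are kept, each of weight at least [c]; two squared deviations from a
    common point add up to at least half the squared difference. *)
Lemma wvar_ge_pair h (c : R) i j : (forall k, c <= p k) -> 0 <= c ->
  c / 2 * (h i - h j) ^+ 2 <= wvar h.
Proof.
move=> cp c0; have [->|ij] := eqVneq i j.
  rewrite subrr expr0n /= mulr0; apply: sumr_ge0 => k _.
  by rewrite mulr_ge0 ?sqr_ge0 // ltW.
have ip : c * ((h i - wmean h) ^+ 2 + (h j - wmean h) ^+ 2) <= wvar h.
  rewrite /wvar (bigD1 i) //= (bigD1 j) 1?eq_sym //= addrA mulrDr.
  rewrite -[leLHS]addr0 lerD //; first by rewrite lerD // ler_wpM2r ?sqr_ge0.
  by apply: sumr_ge0 => k _; rewrite mulr_ge0 ?sqr_ge0 // ltW.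
apply: le_trans ip; rewrite mulrAC -mulrA ler_wpM2l //.
set a := h i; set b := h j; set m := wmean h.
by have := sqr_ge0 ((a - m) + (b - m)); lra.
Qed.

End LogMoment.
(** * Conditional laws of the spins *)

Section Resampling.
Context {R : realType} {q N : nat}.
Context (A : 'M[R]_N) (A_sym : A^T = A) (A_diag : forall i, A i i = 0).
Context (theta : param R q).
Implicit Types (x : config q N) (i j : 'I_N) (r s : 'I_q).

Definition recolour x i s : config q N := [ffun j => if j == i then s else x j].

Lemma recolour_id x i : recolour x i (x i) = x.
Proof. by apply/ffunP => j; rewrite ffunE; case: eqP => [->|]. Qed.

Lemma recolour_twice x i s r : recolour (recolour x i s) i r = recolour x i r.
Proof. by apply/ffunP => j; rewrite !ffunE; case: eqP. Qed.

Lemma recolour_same x i s : recolour x i s i = s.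
Proof. by rewrite ffunE eqxx. Qed.

Lemma recolour_other x i s j : j != i -> recolour x i s j = x j.
Proof. by rewrite ffunE => /negbTE ->. Qed.

(* [(x, s) |-> (recolour x i s, x i)] is an involution. *)
Lemma sum_recolour (F : config q N -> R) i :
  \sum_x \sum_s F (recolour x i s) = q%:R * \sum_x F x.
Proof.
pose phi (u : config q N * 'I_q) := (recolour u.1 i u.2, u.1 i).
have phiK : involutive phi.
  by case=> x s; rewrite /phi /= recolour_twice recolour_id recolour_same.
rewrite pair_big /= (reindex_inj (inv_inj phiK)) /=.
under eq_bigr do rewrite recolour_twice recolour_id.
rewrite -(pair_big predT predT (fun x (s : 'I_q) => F x)) /= mulr_sumr.
by apply: eq_bigr => x _; rewrite sumr_const card_ord mulr_natl.
Qed.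

(** The Potts probability that spin [i] has colour [r] given the other spins;
    [potts_weight_recolour] is what identifies it as such. *)
Definition cond_prob x i r : R :=
  expR (theta.1 * local_field A x i r + ext_field theta.2 r)
  / \sum_(s < q) expR (theta.1 * local_field A x i s + ext_field theta.2 s).

Lemma partition_gt0 (f : 'I_q -> R) r : 0 < \sum_s expR (f s).
Proof.
rewrite (bigD1 r) //= ltr_pwDl ?expR_gt0 //.
by apply: sumr_ge0 => s _; exact: expR_ge0.
Qed.

Lemma cond_prob_gt0 x i r : 0 < cond_prob x i r.
Proof.
rewrite divr_gt0 ?expR_gt0 //.
exact: (partition_gt0 (fun s => theta.1 * local_field A x i s + ext_field theta.2 s)).
Qed.

Lemma cond_prob_sum1 x i : (0 < q)%N -> \sum_r cond_prob x i r = 1.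
Proof.
move=> q0; rewrite -mulr_suml divff // gt_eqF //.
exact: (partition_gt0 (fun s => theta.1 * local_field A x i s + ext_field theta.2 s)
  (Ordinal q0)).
Qed.

Lemma cond_prob_le1 x i r : cond_prob x i r <= 1.
Proof.
rewrite -(@cond_prob_sum1 x i (leq_ltn_trans (leq0n r) (ltn_ord r))).
rewrite (bigD1 r) //= lerDl; apply: sumr_ge0 => s _; exact/ltW/cond_prob_gt0.
Qed.

Lemma local_field_recolour x i s j r :
  local_field A (recolour x i s) j r
  = local_field A x j r + A j i * ((s == r)%:R - (x i == r)%:R).
Proof.
rewrite /local_field (bigD1 i) //= [in RHS](bigD1 i) //= recolour_same.
rewrite (eq_bigr (fun k => A j k * (x k == r)%:R)); first by ring.
by move=> k /recolour_other ->.
Qed.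

Lemma local_field_recolour_same x i s r :
  local_field A (recolour x i s) i r = local_field A x i r.
Proof. by rewrite local_field_recolour A_diag mul0r addr0. Qed.

Lemma cond_prob_recolour_same x i s r :
  cond_prob (recolour x i s) i r = cond_prob x i r.
Proof.
rewrite /cond_prob local_field_recolour_same; congr (_ / _).
by apply: eq_bigr => t _; rewrite local_field_recolour_same.
Qed.

(** [W] collects the energy terms that avoid site [i]. By symmetry and the zero diagonal, row [i]
    and column [i] together give twice the local field, which the factor [theta.1 / 2]
    compensates. *)
Lemma potts_weight_recolour x i : {W : R | forall s,
  potts_weight A theta (recolour x i s)
  = W * expR (theta.1 * local_field A x i s + ext_field theta.2 s)}.
Proof.
pose H0 := theta.1 / 2 * (\sum_(k | k != i) \sum_(l | l != i) A k l * (x k == x l)%:R)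
           + \sum_(k | k != i) \sum_(r < q) ext_field theta.2 r * (x k == r)%:R.
exists (expR H0) => s; rewrite -expRD; congr expR; rewrite /H0.
have Asym k l : A k l = A l k by rewrite -[in LHS]A_sym mxE.
set y := recolour x i s.
have yi : y i = s by exact: recolour_same.
have Ly : \sum_(l | l != i) A i l * (y i == y l)%:R = local_field A x i s.
  rewrite /local_field [in RHS](bigD1 i) //= A_diag mul0r add0r.
  by apply: eq_bigr => l li; rewrite yi /y recolour_other // eq_sym.
have -> : \sum_(k < N) \sum_(l < N) A k l * (y k == y l)%:R
  = \sum_(k | k != i) \sum_(l | l != i) A k l * (x k == x l)%:R
    + 2 * local_field A x i s.
  rewrite (bigD1 i) //= (bigD1 i) //= A_diag mul0r add0r Ly.
  rewrite (eq_bigr (fun k => A i k * (y i == y k)%:R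
      + \sum_(l | l != i) A k l * (x k == x l)%:R)); last first.
    move=> k ki; rewrite (bigD1 i) //= Asym eq_sym; congr (_ + _).
    by apply: eq_bigr => l li; rewrite /y !recolour_other.
  by rewrite big_split /= Ly; ring.
have -> : \sum_(k < N) \sum_(r < q) ext_field theta.2 r * (y k == r)%:R
  = ext_field theta.2 s
    + \sum_(k | k != i) \sum_(r < q) ext_field theta.2 r * (x k == r)%:R.
  rewrite (bigD1 i) //=; congr (_ + _).
    rewrite (bigD1 s) //= yi eqxx mulr1 big1 ?addr0 // => r rs.
    by rewrite eq_sym (negbTE rs) mulr0.
  by apply: eq_bigr => k ki; apply: eq_bigr => r _; rewrite /y recolour_other.
by field.
Qed.

Lemma potts_weight_gt0 x : 0 < potts_weight A theta x.
Proof. exact: expR_gt0. Qed.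

Definition colour_resid x i r : R := (x i == r)%:R - cond_prob x i r.

Lemma colour_resid_le1 x i r : `|colour_resid x i r| <= 1.
Proof.
rewrite /colour_resid ler_norml.
have := cond_prob_gt0 x i r; have := cond_prob_le1 x i r.
by case: (x i == r) => /= p1 p0; apply/andP; split; lra.
Qed.

Definition potts_mean (f : config q N -> R) : R :=
  \sum_x potts_pmf A theta x * f x.

(** The hypothesis says that [g] ignores spin [i]. Summing first over the recolourings of [i], the
    weights are proportional to [e s], and the residual integrates to
    [e r - cond_prob x i r * \sum_s e s = 0]. *)
Lemma colour_resid_centered (g : config q N -> R) i r :
  (forall x s, g (recolour x i s) = g x) ->
  potts_mean (fun x => colour_resid x i r * g x) = 0.
Proof.
move=> gi; pose F x := potts_weight A theta x * (colour_resid x i r * g x).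
have q0 : (0 < q)%N := leq_ltn_trans (leq0n r) (ltn_ord r).
suff F0 : \sum_x F x = 0.
  transitivity ((potts_Z A theta)^-1 * \sum_x F x); last by rewrite F0 mulr0.
  by rewrite mulr_sumr; apply: eq_bigr => x _; rewrite /F /potts_pmf; ring.
have : q%:R * \sum_x F x = 0.
  rewrite -(sum_recolour F i) big1 // => x _.
  have [W HW] := potts_weight_recolour x i.
  set e := fun s => expR (theta.1 * local_field A x i s + ext_field theta.2 s).
  rewrite (eq_bigr (fun s => W * g x * (e s * (s == r)%:R)
     - W * g x * cond_prob x i r * e s)); last first.
    move=> s _; rewrite /F HW gi /colour_resid recolour_same
      cond_prob_recolour_same -/(e s); ring.
  rewrite sumrB -!mulr_sumr.
  have -> : \sum_s e s * (s == r)%:R = e r.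
    rewrite (bigD1 r) //= eqxx mulr1 big1 ?addr0 // => s sr.
    by rewrite (negbTE sr) mulr0.
  have -> : cond_prob x i r = e r / \sum_s e s by [].
  by field; rewrite gt_eqF // (partition_gt0 _ r).
by move/eqP; rewrite mulf_eq0 pnatr_eq0 -leqn0 leqNgt q0 /= => /eqP.
Qed.

End Resampling.

(** * Probabilities and means under the Potts law *)

Section PottsProbability.
Context {R : realType} {q N : nat}.
Context (A : 'M[R]_N) (theta : param R q) (q_gt0 : (0 < q)%N).
Implicit Types (x : config q N) (E F : set (config q N)).

Local Notation Pr := (potts_prob A theta).

Lemma potts_Z_gt0 : 0 < potts_Z A theta.
Proof.
rewrite /potts_Z (bigD1 [ffun=> Ordinal q_gt0]) //= ltr_pwDl ?potts_weight_gt0 //.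
by apply: sumr_ge0 => x _; exact/ltW/potts_weight_gt0.
Qed.

Lemma potts_pmf_ge0 x : 0 <= potts_pmf A theta x.
Proof. by rewrite divr_ge0 ?ltW ?potts_Z_gt0 ?potts_weight_gt0. Qed.

Lemma potts_prob_setT : Pr setT = 1.
Proof.
rewrite /potts_prob (eq_bigl predT); last by move=> x; rewrite in_setT.
by rewrite -mulr_suml divff // gt_eqF // potts_Z_gt0.
Qed.

Lemma le_potts_prob E F : E `<=` F -> Pr E <= Pr F.
Proof.
move=> EF; rewrite /potts_prob big_mkcond [leRHS]big_mkcond /=.
apply: ler_sum => x _; case: ifPn => [/set_mem/EF/mem_set ->//|_].
by case: ifP => // _; exact: potts_pmf_ge0.
Qed.

Lemma potts_prob_le1 E : Pr E <= 1.
Proof. by rewrite -potts_prob_setT le_potts_prob. Qed.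

Lemma potts_probU E F : Pr (E `|` F) <= Pr E + Pr F.
Proof.
rewrite /potts_prob 3![\sum_(x | x \in _) _]big_mkcond -big_split /=.
apply: ler_sum => x _; rewrite in_setU.
by have := potts_pmf_ge0 x; case: (x \in E); case: (x \in F) => /=; lra.
Qed.

Lemma potts_probC E : Pr (~` E) = 1 - Pr E.
Proof.
rewrite -potts_prob_setT /potts_prob 3![\sum_(x | x \in _) _]big_mkcond -sumrB /=.
apply: eq_bigr => x _; rewrite in_setT in_setC.
by case: (x \in E); rewrite /= ?subrr ?subr0.
Qed.

Lemma potts_markov (f : config q N -> R) (K : R) : 0 < K -> (forall x, 0 <= f x) ->
  Pr [set x | K < f x] <= potts_mean A theta f / K.
Proof.
move=> K0 f0; rewrite ler_pdivlMr // /potts_prob big_mkcond mulr_suml.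
apply: ler_sum => x _; case: ifPn => [/set_mem /= Kf|_].
  by apply: ler_wpM2l; [exact: potts_pmf_ge0|exact: ltW].
by rewrite mul0r mulr_ge0 // potts_pmf_ge0.
Qed.

Lemma potts_meanD (f g : config q N -> R) :
  potts_mean A theta (fun x => f x + g x)
  = potts_mean A theta f + potts_mean A theta g.
Proof. by rewrite -big_split; apply: eq_bigr => x _; rewrite mulrDr. Qed.

Lemma potts_mean_sum (I : finType) (f : I -> config q N -> R) :
  potts_mean A theta (fun x => \sum_i f i x) = \sum_i potts_mean A theta (f i).
Proof.
rewrite /potts_mean exchange_big; apply: eq_bigr => x _; exact: mulr_sumr.
Qed.

Lemma potts_mean_le (f : config q N -> R) (c : R) :
  (forall x, f x <= c) -> potts_mean A theta f <= c.
Proof.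
move=> fc; rewrite -[leRHS]mul1r -potts_prob_setT /potts_prob mulr_suml.
rewrite [leRHS](eq_bigl predT); last by move=> x; rewrite in_setT.
by apply: ler_sum => x _; rewrite ler_wpM2l // potts_pmf_ge0.
Qed.

End PottsProbability.

(** * Second moments of conditionally centered sums *)

Section SecondMoment.
Context {R : realType} {q N : nat}.
Context (A : 'M[R]_N) (A_sym : A^T = A) (A_diag : forall i, A i i = 0).
Context (A_ge0 : forall i j, 0 <= A i j).
Context (gamma : R) (A_row : forall i, \sum_j A i j <= gamma).
Context (theta : param R q) (q_gt0 : (0 < q)%N).
Implicit Types (x y : config q N) (i j : 'I_N) (r s : 'I_q).

Lemma A_symE i j : A i j = A j i.
Proof. by rewrite -[in LHS]A_sym mxE. Qed.

Lemma local_field_ge0 x i r : 0 <= local_field A x i r.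
Proof. by apply: sumr_ge0 => j _; rewrite mulr_ge0 ?ler0n. Qed.

Lemma local_field_le x i r : local_field A x i r <= gamma.
Proof.
apply: le_trans (A_row i); apply: ler_sum => j _.
by rewrite -[leRHS]mulr1 ler_wpM2l // lern1 leq_b1.
Qed.

Lemma field_gap_le x i r s : `|field_gap A x r s i| <= gamma.
Proof.
rewrite ler_norml /field_gap.
have := local_field_ge0 x i r; have := local_field_ge0 x i s.
have := local_field_le x i r; have := local_field_le x i s.
by move=> *; apply/andP; split; lra.
Qed.

(** Numerator and partition function each change by a factor within [expR (b * d)] of 1 in ratio, so
    the quotient loses at most the factor [expR (- (2 * b * d)) >= 1 - 2 * b * d]; then
    [cond_prob <= 1] turns this into an additive bound. *)
Lemma cond_prob_lip_aux x y j r (d : R) :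
  (forall t, `|local_field A y j t - local_field A x j t| <= d) ->
  cond_prob A theta x j r - cond_prob A theta y j r <= 2 * `|theta.1| * d.
Proof.
move=> dP; set b := `|theta.1|.
have bd t : `|theta.1 * local_field A y j t - theta.1 * local_field A x j t| <= b * d.
  by rewrite -mulrBr normrM ler_wpM2l.
set ex := fun t => expR (theta.1 * local_field A x j t + ext_field theta.2 t).
set ey := fun t => expR (theta.1 * local_field A y j t + ext_field theta.2 t).
have up t : ey t <= ex t * expR (b * d).
  by rewrite -expRD ler_expR; have := bd t; rewrite ler_norml; lra.
have lo t : ex t * expR (- (b * d)) <= ey t.
  by rewrite -expRD ler_expR; have := bd t; rewrite ler_norml; lra.
have sx : 0 < \sum_t ex t by exact: (partition_gt0 _ r).
have sy : 0 < \sum_t ey t by exact: (partition_gt0 _ r).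
have pe : cond_prob A theta x j r * expR (- (2 * b * d)) <= cond_prob A theta y j r.
  rewrite /cond_prob -/(ex r) -/(ey r) -/(\sum_t ex t) -/(\sum_t ey t).
  rewrite ler_pdivlMr //.
  have sup : \sum_t ey t <= (\sum_t ex t) * expR (b * d).
    by rewrite mulr_suml; apply: ler_sum => t _; exact: up.
  apply: le_trans (lo r).
  apply: (@le_trans _ _ (ex r / (\sum_t ex t) * expR (- (2 * b * d)) *
     ((\sum_t ex t) * expR (b * d)))).
    by rewrite ler_wpM2l // mulr_ge0 ?expR_ge0 // divr_ge0 ?expR_ge0 // ltW.
  rewrite (_ : _ * _ = ex r * (expR (- (2 * b * d)) * expR (b * d))); last first.
    by field; rewrite gt_eqF.
  by rewrite -expRD le_eqVlt; apply/orP; left; apply/eqP; congr (_ * expR _); ring.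
have e1 : 1 - 2 * b * d <= expR (- (2 * b * d)) by exact: expR_ge1Dx.
have d0 : 0 <= 2 * b * d.
  by apply: mulr_ge0; [rewrite mulr_ge0 ?normr_ge0|exact: le_trans (dP r)].
have p0 := cond_prob_gt0 A theta x j r; have p1 := cond_prob_le1 A theta x j r.
have := ler_wpM2l (ltW p0) e1; have := ler_wpM2r d0 p1.
by lra.
Qed.

Lemma cond_prob_lip x y j r (d : R) :
  (forall t, `|local_field A y j t - local_field A x j t| <= d) ->
  `|cond_prob A theta y j r - cond_prob A theta x j r| <= 2 * `|theta.1| * d.
Proof.
move=> dP; rewrite ler_norml; have := cond_prob_lip_aux r dP.
have := @cond_prob_lip_aux y x j r d (fun t => _).
by move=> /(_ _) h1 h2; have := h1 (fun t => ltac:(rewrite distrC; exact: dP)); lra.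
Qed.

Lemma local_field_lip x i s j r :
  `|local_field A (recolour x i s) j r - local_field A x j r| <= A i j.
Proof.
rewrite local_field_recolour addrC addKr normrM (A_symE i j) ger0_norm //.
rewrite -[leRHS]mulr1 ler_wpM2l // ler_norml.
by case: (s == r); case: (x i == r) => /=; apply/andP; split; lra.
Qed.

(* Sensitivity of [h x j] to the colour of [i] controlled by the coupling; since
   [A] has zero diagonal, [h x i] does not depend on [x i]. *)
Definition local_stat (C L : R) (h : config q N -> 'I_N -> R) :=
  [/\ 0 <= C, 0 <= L, forall x i, `|h x i| <= C
    & forall x i s j, `|h (recolour x i s) j - h x j| <= L * A i j].

Lemma local_stat_cst (c : R) : local_stat `|c| 0 (fun _ _ => c).
Proof. by split=> // x i s j; rewrite subrr normr0 mul0r. Qed.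

Lemma local_stat_field r : 0 <= gamma ->
  local_stat gamma 1 (fun x i => local_field A x i r).
Proof.
move=> g0; split=> // [x i|x i s j]; last by rewrite mul1r local_field_lip.
by rewrite ger0_norm ?local_field_ge0 // local_field_le.
Qed.

Lemma local_stat_gap r s : 0 <= gamma ->
  local_stat gamma 2 (fun x i => field_gap A x r s i).
Proof.
move=> g0; split=> // [x i|x i t j]; first exact: field_gap_le.
have := local_field_lip x i t j r; have := local_field_lip x i t j s.
by rewrite /field_gap !ler_norml; lra.
Qed.

Lemma local_stat_prob r :
  local_stat 1 (2 * `|theta.1|) (fun x i => cond_prob A theta x i r).
Proof.
split=> [//||x i|x i s j]; first by rewrite mulr_ge0.
  by rewrite ger0_norm ?cond_prob_le1 // ltW // cond_prob_gt0.
by apply: cond_prob_lip => t; exact: local_field_lip.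
Qed.

Lemma local_statM C L h C' L' h' : local_stat C L h -> local_stat C' L' h' ->
  local_stat (C * C') (C * L' + C' * L) (fun x i => h x i * h' x i).
Proof.
move=> [C0 L0 hC hL] [C'0 L'0 h'C h'L]; split=> [|||x i s j].
- exact: mulr_ge0.
- by rewrite addr_ge0 ?mulr_ge0.
- by move=> x i; rewrite normrM ler_pM.
rewrite (_ : _ - _ = h (recolour x i s) j * (h' (recolour x i s) j - h' x j)
  + h' x j * (h (recolour x i s) j - h x j)); last by ring.
rewrite mulrDl -!mulrA (le_trans (ler_normD _ _)) // !normrM.
by rewrite lerD // ler_pM.
Qed.

(** With [h = 1] this is the derivative of the log pseudo-likelihood in the field of colour [r];
    with [h] the local field of colour [r], summing over [r] gives the derivative in the inverse
    temperature. *)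
Definition score (h : config q N -> 'I_N -> R) r x : R :=
  \sum_i h x i * colour_resid A theta x i r.

(** Expand the square: diagonal terms are at most [C ^+ 2], and the term of [i != j] is at most a
    constant times [A i j] because spin [j] feels spin [i] only through the coupling. The row sums
    of [A] then leave a total of order [N]. *)
Lemma score_second_moment C L h r : local_stat C L h ->
  potts_mean A theta (fun x => score h r x ^+ 2)
  <= N%:R * (C ^+ 2 + C * (L + 2 * `|theta.1| * C) * gamma).
Proof.
move=> [C0 L0 hC hL].
have hsame x i s : h (recolour x i s) i = h x i.
  by apply/eqP; rewrite -subr_eq0 -normr_le0 (le_trans (hL x i s i)) // A_diag mulr0.
pose D x i := h x i * colour_resid A theta x i r.
have DC x i : `|D x i| <= C.
  rewrite normrM -[leRHS]mulr1 ler_pM //; exact: colour_resid_le1.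
have DL x i s j : j != i ->
    `|D x j - D (recolour x i s) j| <= (L + 2 * `|theta.1| * C) * A i j.
  move=> ji; rewrite /D distrC.
  set y := recolour x i s.
  rewrite (_ : _ - _ = (h y j - h x j) * colour_resid A theta y j r
    - h x j * (cond_prob A theta y j r - cond_prob A theta x j r)); last first.
    by rewrite /colour_resid /y recolour_other //; ring.
  rewrite (le_trans (ler_normB _ _)) // !normrM mulrDl lerD //.
    by rewrite -[leRHS]mulr1 ler_pM // ?colour_resid_le1 // hL.
  rewrite mulrC [_ * C]mulrC mulrC -mulrA ler_pM //.
  by apply: cond_prob_lip => t; exact: local_field_lip.
have cross i j : potts_mean A theta (fun x => D x i * D x j)
    <= C ^+ 2 * (i == j)%:R + C * (L + 2 * `|theta.1| * C) * A i j.
  have [<-|ij] := eqVneq i j.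
    rewrite A_diag mulr0 mulr1 addr0; apply: potts_mean_le => // x.
    by rewrite -expr2 -real_normK ?num_real // lerXn2r ?nnegrE // (le_trans _ (DC x i)).
  rewrite mulr0 add0r.
  (* The subtracted [D (recolour x i r) j] does not depend on spin [i], so its product with the
     centred [D x i] has mean zero; what remains is a difference controlled by [DL]. *)
  have -> : potts_mean A theta (fun x => D x i * D x j)
      = potts_mean A theta (fun x => D x i * (D x j - D (recolour x i r) j)).
    apply/eqP; rewrite -subr_eq0 -sumrB; apply/eqP.
    rewrite -[RHS](colour_resid_centered A_sym A_diag theta r
      (g := fun x => h x i * D (recolour x i r) j) (i := i)); last first.
      by move=> x s; rewrite hsame recolour_twice.
    by apply: eq_bigr => x _; rewrite /D; ring.
  apply: potts_mean_le => // x; apply: le_trans (ler_norm _) _.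
  rewrite normrM -mulrA ler_pM //; apply: DL.
  by rewrite eq_sym.
rewrite (_ : potts_mean _ _ _
    = \sum_i \sum_j potts_mean A theta (fun x => D x i * D x j)); last first.
  under eq_bigr => i _ do rewrite -potts_mean_sum.
  rewrite -potts_mean_sum; apply: eq_bigr => x _; congr (_ * _).
  by rewrite expr2 mulr_suml; apply: eq_bigr => i _; rewrite mulr_sumr.
rewrite mulr_natl -[N in X in _ <= X]card_ord -sumr_const.
apply: ler_sum => i _.
apply: le_trans (ler_sum _ (fun j _ => cross i j)) _.
rewrite big_split /= -!mulr_sumr lerD //.
  rewrite (bigD1 i) //= eqxx big1 ?addr0 ?mulr1 // => j ji.
  by rewrite eq_sym (negbTE ji).
by apply: ler_wpM2l => //; rewrite !(mulr_ge0, addr_ge0).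
Qed.

End SecondMoment.

(** * The parameter space and its Euclidean norm *)

Section ParameterSpace.
Context {R : realType} {q : nat}.
Implicit Types (B : 'rV[R]_(q.-1)) (r : 'I_q) (d theta : param R q) (s : R).

Definition pshift theta d : param R q := (theta.1 + d.1, theta.2 + d.2).
Definition pscale s d : param R q := (s * d.1, s *: d.2).

Lemma ext_fieldD B B' r : ext_field (B + B') r = ext_field B r + ext_field B' r.
Proof. by rewrite /ext_field; case: insub => [k|]; rewrite ?mxE ?addr0. Qed.

Lemma ext_fieldZ s B r : ext_field (s *: B) r = s * ext_field B r.
Proof. by rewrite /ext_field; case: insub => [k|]; rewrite ?mxE ?mulr0. Qed.

Lemma last_colour_subproof : (0 < q)%N -> (q.-1 < q)%N.
Proof. by case: q. Qed.

Definition last_colour (q_gt0 : (0 < q)%N) : 'I_q := Ordinal (last_colour_subproof q_gt0).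

Lemma ext_field_last (q_gt0 : (0 < q)%N) B : ext_field B (last_colour q_gt0) = 0.
Proof. by rewrite /ext_field insubF //= ltnn. Qed.

Lemma ext_field_widen B (k : 'I_(q.-1)) : ext_field B (widen_ord (leq_pred q) k) = B ord0 k.
Proof. by rewrite /ext_field /= valK. Qed.

Definition pnorm2 d : R := d.1 ^+ 2 + \sum_(r < q.-1) d.2 ord0 r ^+ 2.
Definition pnorm d : R := Num.sqrt (pnorm2 d).

Lemma pnorm2_ge0 d : 0 <= pnorm2 d.
Proof. by rewrite addr_ge0 ?sqr_ge0 //; apply: sumr_ge0 => r _; exact: sqr_ge0. Qed.

Lemma pnorm_ge0 d : 0 <= pnorm d. Proof. exact: sqrtr_ge0. Qed.

Lemma sqr_pnorm d : pnorm d ^+ 2 = pnorm2 d.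
Proof. by rewrite sqr_sqrtr // pnorm2_ge0. Qed.

Lemma pnorm_scale s d : pnorm (pscale s d) = `|s| * pnorm d.
Proof.
rewrite /pnorm -sqrtr_sqr -sqrtrM ?sqr_ge0 //; congr Num.sqrt.
rewrite /pnorm2 /= mulrDr mulr_sumr exprMn; congr (_ + _).
by apply: eq_bigr => r _; rewrite mxE exprMn.
Qed.

Lemma fst_le_pnorm d : `|d.1| <= pnorm d.
Proof.
rewrite -sqrtr_sqr ler_sqrt ?pnorm2_ge0 // lerDl.
by apply: sumr_ge0 => r _; exact: sqr_ge0.
Qed.

Lemma ext_field_le_pnorm d r : `|ext_field d.2 r| <= pnorm d.
Proof.
rewrite /ext_field; case: insubP => [k _ _|_]; last by rewrite normr0 pnorm_ge0.
rewrite -sqrtr_sqr ler_sqrt ?pnorm2_ge0 // /pnorm2 (bigD1 k) //= addrCA lerDl.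
by rewrite addr_ge0 ?sqr_ge0 //; apply: sumr_ge0 => t _; exact: sqr_ge0.
Qed.

(** A field that is constant in the colour takes everywhere its value 0 at the last colour. *)
Lemma pnorm_eq0 (q_gt0 : (0 < q)%N) d : d.1 = 0 ->
  (forall r, ext_field d.2 r = ext_field d.2 (last_colour q_gt0)) -> d = (0, 0).
Proof.
case: d => u v /= -> v0; congr pair; apply/rowP => k; rewrite mxE.
by rewrite -ext_field_widen v0 ext_field_last.
Qed.

End ParameterSpace.

(** * Score and curvature of the log pseudo-likelihood *)

Section PseudoLikelihood.
Context {R : realType} {q N : nat}.
Context (A : 'M[R]_N) (A_ge0 : forall i j, 0 <= A i j).
Context (gamma : R) (A_row : forall i, \sum_j A i j <= gamma) (gamma_ge0 : 0 <= gamma).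
Context (q_gt0 : (0 < q)%N) (x : config q N).
Implicit Types (theta d : param R q) (i j : 'I_N) (r s : 'I_q).

Local Notation loglik := (log_pseudolik A x).

(** The logarithm of the conditional probability up to a normalization common to all colours. It is
    linear in [d], hence used both for parameters and for increments. *)
Definition log_odds d i r : R := d.1 * local_field A x i r + ext_field d.2 r.

Lemma log_odds_shift theta d i r :
  log_odds (pshift theta d) i r = log_odds theta i r + log_odds d i r.
Proof. by rewrite /log_odds /= ext_fieldD; ring. Qed.

Lemma log_odds_scale (s : R) d i r : log_odds (pscale s d) i r = s * log_odds d i r.
Proof. by rewrite /log_odds /= ext_fieldZ; ring. Qed.

Lemma log_odds_le d i r : `|log_odds d i r| <= (gamma + 1) * pnorm d.
Proof.
rewrite /log_odds (le_trans (ler_normD _ _)) // mulrDl mul1r lerD ?ext_field_le_pnorm //.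
rewrite normrM mulrC ler_pM ?fst_le_pnorm // ger0_norm.
  exact: local_field_le.
exact: local_field_ge0.
Qed.

Lemma sum_indicator (f : 'I_q -> R) (t : 'I_q) : \sum_r f r * (t == r)%:R = f t.
Proof.
rewrite (bigD1 t) //= eqxx mulr1 big1 ?addr0 // => r rt.
by rewrite eq_sym (negbTE rt) mulr0.
Qed.

Lemma log_pseudolikE theta : loglik theta =
  \sum_i (log_odds theta i (x i) - ln (\sum_r expR (log_odds theta i r))).
Proof.
rewrite sumrB /log_pseudolik mulr_sumr -big_split /=; congr (_ - _).
by apply: eq_bigr => i _; rewrite !sum_indicator.
Qed.

Local Notation p theta := (cond_prob A theta x).

(** The ratio of the partition functions at the two parameters is the moment generating function of
    [log_odds d i] under the conditional law at [theta]. This exact formula lets the log-moment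
    inequalities replace Taylor expansions. *)
Lemma log_pseudolik_shift theta d : loglik (pshift theta d) - loglik theta
  = \sum_i (log_odds d i (x i) - ln (\sum_r p theta i r * expR (log_odds d i r))).
Proof.
rewrite !log_pseudolikE -sumrB; apply: eq_bigr => i _.
rewrite log_odds_shift.
have Z0 : 0 < \sum_r expR (log_odds theta i r).
  exact: (partition_gt0 _ (Ordinal q_gt0)).
have -> : \sum_r expR (log_odds (pshift theta d) i r)
   = (\sum_r expR (log_odds theta i r)) * \sum_r p theta i r * expR (log_odds d i r).
  rewrite mulr_sumr; apply: eq_bigr => r _.
  rewrite log_odds_shift expRD /cond_prob -!/(log_odds _ _ _).
  by field; rewrite gt_eqF.
rewrite lnM ?posrE //; first by ring.
by apply: mgf_gt0; [move=> r; exact: cond_prob_gt0|exact: cond_prob_sum1].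
Qed.

(** By [log_mgf_scale] at each site, the increment at the fraction [s] of the way is at least [s]
    times the full increment. *)
Lemma log_pseudolik_concave theta d (s : R) : 0 <= s <= 1 ->
  loglik theta <= loglik (pshift theta d) ->
  loglik theta <= loglik (pshift theta (pscale s d)).
Proof.
move=> s01; rewrite -subr_ge0 log_pseudolik_shift => h.
rewrite -subr_ge0 log_pseudolik_shift.
have /andP[s0 s1] := s01.
apply: le_trans (mulr_ge0 s0 h) _; rewrite mulr_sumr; apply: ler_sum => i _.
rewrite log_odds_scale mulrBr lerD2l lerN2.
under eq_bigr do rewrite log_odds_scale.
by apply: log_mgf_scale => //; [move=> r; exact: cond_prob_gt0|exact: cond_prob_sum1].
Qed.

Definition directional_score theta d : R :=
  \sum_i \sum_r log_odds d i r * colour_resid A theta x i r.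

(** Minus the second derivative of the log pseudo-likelihood at [theta] in direction [d]: the
    conditional variances of [log_odds d i], summed over the sites. *)
Definition info_form theta d : R :=
  \sum_i \sum_r p theta i r * (log_odds d i r - \sum_s p theta i s * log_odds d i s) ^+ 2.

Lemma log_pseudolik_quad theta d : (forall i r, `|log_odds d i r| <= 1) ->
  loglik (pshift theta d) - loglik theta
  <= directional_score theta d - info_form theta d / 5.
Proof.
move=> d1; rewrite log_pseudolik_shift mulr_suml -sumrB; apply: ler_sum => i _.
have -> : \sum_r log_odds d i r * colour_resid A theta x i r
   = log_odds d i (x i) - \sum_r p theta i r * log_odds d i r.
  rewrite -[in RHS](sum_indicator (log_odds d i)) -sumrB.
  by apply: eq_bigr => r _; rewrite /colour_resid; ring.
have := log_mgf_quad (fun r => cond_prob_gt0 A theta x i r)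
  (cond_prob_sum1 A theta x i q_gt0) (d1 i).
by lra.
Qed.

Lemma directional_score_scale theta d (s : R) :
  directional_score theta (pscale s d) = s * directional_score theta d.
Proof.
rewrite mulr_sumr; apply: eq_bigr => i _; rewrite mulr_sumr; apply: eq_bigr => r _.
by rewrite log_odds_scale mulrA.
Qed.

Lemma info_form_scale theta d (s : R) :
  info_form theta (pscale s d) = s ^+ 2 * info_form theta d.
Proof.
rewrite mulr_sumr; apply: eq_bigr => i _; rewrite mulr_sumr; apply: eq_bigr => r _.
have -> : \sum_t p theta i t * log_odds (pscale s d) i t
    = s * \sum_t p theta i t * log_odds d i t.
  by rewrite mulr_sumr; apply: eq_bigr => t _; rewrite log_odds_scale mulrCA.
by rewrite log_odds_scale; ring.
Qed.

Definition score_energy theta : R :=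
  \sum_r (score A theta (fun y i => local_field A y i r) r x ^+ 2
          + score A theta (fun _ _ => 1) r x ^+ 2).

(** The directional score is a combination of two scores for each of the [q] colours; every
    coefficient is at most [pnorm d] and every score at most the root of the energy. *)
Lemma directional_score_le theta d :
  `|directional_score theta d| <= 2 * q%:R * Num.sqrt (score_energy theta) * pnorm d.
Proof.
set Q := score_energy theta.
have sq r : score A theta (fun y i => local_field A y i r) r x ^+ 2
          + score A theta (fun _ _ => 1) r x ^+ 2 <= Q.
  rewrite /Q /score_energy (bigD1 r) //= lerDl.
  by apply: sumr_ge0 => s _; rewrite addr_ge0 ?sqr_ge0.
have -> : directional_score theta d = \sum_r
    (d.1 * score A theta (fun y i => local_field A y i r) r x
     + ext_field d.2 r * score A theta (fun _ _ => 1) r x).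
  rewrite /directional_score exchange_big; apply: eq_bigr => r _.
  rewrite /score !mulr_sumr -big_split; apply: eq_bigr => i _ /=.
  by rewrite /log_odds; ring.
have sQ (a b : R) : a ^+ 2 + b ^+ 2 <= Q ->
    (`|a| <= Num.sqrt Q) * (`|b| <= Num.sqrt Q).
  move=> abQ; have Q0 : 0 <= Q by apply: le_trans abQ; rewrite addr_ge0 ?sqr_ge0.
  by split; rewrite -sqrtr_sqr ler_sqrt //; apply: le_trans abQ;
    rewrite ?lerDl ?lerDr sqr_ge0.
apply: le_trans (ler_norm_sum _ _ _) _.
apply: (@le_trans _ _ (\sum_(r < q) (2 * Num.sqrt Q * pnorm d))); last first.
  by rewrite sumr_const card_ord -mulr_natl le_eqVlt; apply/orP; left; apply/eqP; ring.
apply: ler_sum => r _; have [sa sb] := sQ _ _ (sq r).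
rewrite (le_trans (ler_normD _ _)) // !normrM.
rewrite [leRHS](_ : _ = pnorm d * Num.sqrt Q + pnorm d * Num.sqrt Q); last by ring.
by rewrite lerD // ler_pM ?fst_le_pnorm ?ext_field_le_pnorm.
Qed.

(** With [b = (gamma + 1) * pnorm theta] bounding all log-odds, a numerator is at least [expR (- b)]
    and a partition function at most [q%:R * expR b]. *)
Definition cond_prob_floor theta : R :=
  expR (- (2 * ((gamma + 1) * pnorm theta))) / q%:R.

Lemma cond_prob_floor_gt0 theta : 0 < cond_prob_floor theta.
Proof. by rewrite divr_gt0 ?expR_gt0 ?ltr0n. Qed.

Lemma cond_prob_floor_le theta i r : cond_prob_floor theta <= p theta i r.
Proof.
set b := (gamma + 1) * pnorm theta.
have lb s : `|log_odds theta i s| <= b by exact: log_odds_le.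
have Z0 : 0 < \sum_s expR (log_odds theta i s) by exact: (partition_gt0 _ r).
have qR : 0 < q%:R :> R by rewrite ltr0n.
rewrite /cond_prob_floor /cond_prob -!/(log_odds _ _ _) ler_pdivlMr // mulrAC ler_pdivrMr //.
apply: (@le_trans _ _ (expR (- (2 * b)) * (q%:R * expR b))).
  rewrite ler_wpM2l ?expR_ge0 // mulr_natl -[q in X in _ <= X]card_ord -sumr_const.
  by apply: ler_sum => s _; rewrite ler_expR; have := lb s; rewrite /log_odds ler_norml; lra.
rewrite mulrCA -expRD mulrC ler_wpM2r ?ler_expR //.
by have := lb r; rewrite /log_odds ler_norml; lra.
Qed.

Lemma info_form_ge_pair theta d r s :
  cond_prob_floor theta / 2 * (\sum_i (log_odds d i r - log_odds d i s) ^+ 2)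
  <= info_form theta d.
Proof.
rewrite mulr_sumr; apply: ler_sum => i _.
apply: wvar_ge_pair; first by move=> k; exact: cond_prob_gt0.
  by move=> k; exact: cond_prob_floor_le.
exact/ltW/cond_prob_floor_gt0.
Qed.

(** * Gap variances, lower bound on the curvature, localization of the maximizer *)

Context (N_gt0 : (0 < N)%N).

Definition gap_mean r s : R := mean_local_field A x r - mean_local_field A x s.

(** The empirical variance over the sites of the gap between colours [r] and [s]; [T_stat] is its
    sum over the pairs. *)
Definition gap_var r s : R :=
  N%:R^-1 * (\sum_(i < N) (local_field A x i r - local_field A x i s) ^+ 2)
  - gap_mean r s ^+ 2.

Let NR : 0 < N%:R :> R. Proof. by rewrite ltr0n. Qed.

Lemma gap_meanE r s : gap_mean r s = N%:R^-1 * \sum_i field_gap A x r s i.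
Proof. by rewrite /gap_mean /mean_local_field -mulrBr -sumrB. Qed.

Lemma gap_meanK r s : \sum_i field_gap A x r s i = N%:R * gap_mean r s.
Proof. by rewrite gap_meanE mulVKf // gt_eqF. Qed.

(** Variance plus squared mean of the affine image of the gaps. *)
Lemma sum_affine_gap r s (u w : R) : \sum_i (u * field_gap A x r s i + w) ^+ 2
  = N%:R * (u ^+ 2 * gap_var r s + (u * gap_mean r s + w) ^+ 2).
Proof.
rewrite (eq_bigr (fun i => u ^+ 2 * (field_gap A x r s i) ^+ 2
   + 2 * u * w * field_gap A x r s i + w ^+ 2)); last by move=> i _; ring.
rewrite !big_split /= -!mulr_sumr gap_meanK sumr_const card_ord -mulr_natl.
rewrite /gap_var /field_gap; field; by rewrite gt_eqF.
Qed.

Lemma gap_var_ge0 r s : 0 <= gap_var r s.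
Proof.
have := sum_affine_gap r s 1 (- gap_mean r s).
rewrite expr1n !mul1r subrr expr0n /= addr0 => h.
rewrite -(pmulr_rge0 _ NR) -h; apply: sumr_ge0 => i _; exact: sqr_ge0.
Qed.

Lemma sum_sqr_gap_le r s : \sum_i field_gap A x r s i ^+ 2 <= N%:R * gamma ^+ 2.
Proof.
rewrite mulr_natl -[N in X in _ <= X]card_ord -sumr_const; apply: ler_sum => i _.
by rewrite -real_normK ?num_real // lerXn2r ?nnegrE // field_gap_le.
Qed.

Lemma gap_var_mean_le r s : gap_var r s + gap_mean r s ^+ 2 <= gamma ^+ 2.
Proof. by rewrite /gap_var subrK mulrC ler_pdivrMr // mulrC sum_sqr_gap_le. Qed.

Lemma T_statE : T_stat A x = \sum_(r < q) \sum_(s < q | (r < s)%N) gap_var r s.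
Proof. by []. Qed.

Lemma T_stat_ge0 : 0 <= T_stat A x.
Proof.
by rewrite T_statE; apply: sumr_ge0 => r _; apply: sumr_ge0 => s _; exact: gap_var_ge0.
Qed.

Lemma T_stat_le_pairs (M : R) : 0 <= M -> (forall r s, (r < s)%N -> gap_var r s <= M) ->
  T_stat A x <= q%:R ^+ 2 * M.
Proof.
move=> M0 vM; rewrite T_statE.
apply: (@le_trans _ _ (\sum_(r < q) \sum_(s < q) M)); last first.
  by rewrite !sumr_const card_ord -mulrnA -[leLHS]mulr_natl natrM expr2.
apply: ler_sum => r _; rewrite big_mkcond; apply: ler_sum => s _.
by case: ifP => // /vM.
Qed.

Lemma log_odds_gap d i r s : log_odds d i r - log_odds d i s
  = d.1 * field_gap A x r s i + (ext_field d.2 r - ext_field d.2 s).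
Proof. by rewrite /log_odds /field_gap; ring. Qed.

Definition info_const theta : R :=
  2 * q%:R ^+ 2 * (1 + 4 * q%:R * gamma ^+ 2) / cond_prob_floor theta.

Lemma info_const_ge0 theta : 0 <= info_const theta.
Proof.
rewrite divr_ge0 ?(ltW (cond_prob_floor_gt0 _)) // !mulr_ge0 ?sqr_ge0 //.
by rewrite addr_ge0 // !mulr_ge0 ?sqr_ge0.
Qed.

(* The coefficient [d.1] is controlled by averaging over pairs of colours;
   comparison with the last colour, whose field is 0, then controls [d.2]. *)
Lemma info_form_ge theta d :
  N%:R * T_stat A x * pnorm2 d <= info_const theta * info_form theta d.
Proof.
set c := cond_prob_floor theta; set V := info_form theta d; set T := T_stat A x.
have c0 : 0 < c := cond_prob_floor_gt0 theta.
have T0 : 0 <= T := T_stat_ge0.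
have g20 := sqr_ge0 gamma; have q20 := sqr_ge0 (q%:R : R).
have pair r s : c / 2 * (N%:R * (d.1 ^+ 2 * gap_var r s
    + (d.1 * gap_mean r s + (ext_field d.2 r - ext_field d.2 s)) ^+ 2)) <= V.
  rewrite -sum_affine_gap; apply: le_trans (info_form_ge_pair theta d r s).
  by rewrite le_eqVlt; apply/orP; left; apply/eqP; congr (_ * _);
    apply: eq_bigr => i _; rewrite log_odds_gap.
have V0 : 0 <= V.
  apply: sumr_ge0 => i _; apply: sumr_ge0 => r _.
  by rewrite mulr_ge0 ?sqr_ge0 // ltW // cond_prob_gt0.
have cN : 0 < c / 2 * N%:R by rewrite mulr_gt0 // divr_gt0.
(* Sum [pair] over [r < s], dropping the squared means: the variances add up to [T]. *)
have hu : c / 2 * N%:R * T * d.1 ^+ 2 <= q%:R ^+ 2 * V.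
  have -> : c / 2 * N%:R * T * d.1 ^+ 2
      = \sum_(r < q) \sum_(s < q | (r < s)%N) c / 2 * N%:R * (d.1 ^+ 2 * gap_var r s).
    rewrite /T T_statE mulrAC mulr_sumr; apply: eq_bigr => r _.
    by rewrite mulr_sumr; apply: eq_bigr => s _; rewrite mulrA.
  apply: (@le_trans _ _ (\sum_(r < q) \sum_(s < q) V)); last first.
    by rewrite !sumr_const card_ord -mulrnA -[leLHS]mulr_natl natrM expr2.
  apply: ler_sum => r _; rewrite big_mkcond; apply: ler_sum => s _.
  case: ifP => // _; apply: le_trans (pair r s).
  by rewrite -mulrA !ler_wpM2l // ?lerDl ?sqr_ge0 // ltW // divr_gt0.
have hT : T <= q%:R ^+ 2 * gamma ^+ 2.
  apply: T_stat_le_pairs => // r s _; apply: le_trans (gap_var_mean_le r s).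
  by rewrite lerDl sqr_ge0.
have hv r : c / 2 * N%:R * T * ext_field d.2 r ^+ 2 <= 4 * q%:R ^+ 2 * gamma ^+ 2 * V.
  have := pair r (last_colour q_gt0); rewrite ext_field_last subr0.
  set w := ext_field _ _; set u := d.1 in hu *; set D := gap_mean _ _ => h1.
  have h2 : c / 2 * N%:R * (u * D + w) ^+ 2 <= V.
    apply: le_trans h1; rewrite mulrA ler_wpM2l //; first exact: ltW.
    by rewrite lerDr mulr_ge0 ?sqr_ge0 // gap_var_ge0.
  have D2 : D ^+ 2 <= gamma ^+ 2.
    by apply: le_trans (gap_var_mean_le r (last_colour q_gt0)); rewrite lerDr gap_var_ge0.
  (* Write [w] as [(u * D + w) - u * D]. After multiplication by [T], the first part is controlled
     by [h2] and the bound on [T], the second by [hu]. *)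
  have w2 : w ^+ 2 <= 2 * (u * D + w) ^+ 2 + 2 * (u ^+ 2 * gamma ^+ 2).
    have := sqr_ge0 ((u * D + w) + u * D).
    have := ler_wpM2l (sqr_ge0 u) D2.
    lra.
  have cNT : 0 <= c / 2 * N%:R * T by rewrite mulr_ge0 // ltW.
  apply: le_trans (ler_wpM2l cNT w2) _.
  rewrite [leLHS](_ : _ = 2 * (T * (c / 2 * N%:R * (u * D + w) ^+ 2))
     + 2 * (gamma ^+ 2 * (c / 2 * N%:R * T * u ^+ 2))); last by ring.
  have h3 := ler_wpM2l T0 h2; have h4 := ler_wpM2r V0 hT; have h5 := ler_wpM2l g20 hu.
  by lra.
have total : c / 2 * (N%:R * T * pnorm2 d)
    <= q%:R ^+ 2 * (1 + 4 * q%:R * gamma ^+ 2) * V.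
  have -> : c / 2 * (N%:R * T * pnorm2 d) = c / 2 * N%:R * T * d.1 ^+ 2
     + \sum_(k < q.-1) c / 2 * N%:R * T * d.2 ord0 k ^+ 2.
    by rewrite -mulr_sumr /pnorm2; ring.
  rewrite [leRHS](_ : _ = q%:R ^+ 2 * V
    + q%:R * (4 * q%:R ^+ 2 * gamma ^+ 2 * V)); last by ring.
  rewrite lerD //.
  apply: (@le_trans _ _ (\sum_(k < q.-1) (4 * q%:R ^+ 2 * gamma ^+ 2 * V))).
    by apply: ler_sum => k _; have := hv (widen_ord (leq_pred q) k); rewrite ext_field_widen.
  rewrite sumr_const card_ord -[leLHS]mulr_natl ler_wpM2r ?ler_nat ?leq_pred //.
  by rewrite !mulr_ge0.
rewrite /info_const -/c [leRHS]mulrAC ler_pdivlMr //.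
by move: total; set X := _ * pnorm2 d; set Y := 1 + _; lra.
Qed.

(** The quadratic upper bound holds only for short increments, so it is used at a point of the
    segment from [theta] to the maximizer, where concavity keeps the likelihood at least its value
    at [theta]. The 10 is the 5 of [log_pseudolik_quad] times the 2 of [directional_score_le]. *)
Lemma maximizer_in_ball theta thetahat : maximizes_pseudolik A x thetahat ->
  0 < T_stat A x ->
  (gamma + 1) * (10 * q%:R * info_const theta * Num.sqrt (score_energy theta))
    < N%:R * T_stat A x ->
  N%:R * T_stat A x * l2_dist thetahat theta
    <= 10 * q%:R * info_const theta * Num.sqrt (score_energy theta).
Proof.
move=> thmax T0; set M := 10 * _ * _ * _; set NT := N%:R * _ => MT.
pose d : param R q := (thetahat.1 - theta.1, thetahat.2 - theta.2).
have dE : pshift theta d = thetahat.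
  by case: (thetahat) @d => a b; rewrite /pshift /= !subrKC.
have lE : l2_dist thetahat theta = pnorm d.
  by rewrite /l2_dist /pnorm /pnorm2 /=; congr (Num.sqrt (_ + _));
    apply: eq_bigr => r _; rewrite !mxE.
rewrite lE.
have g1 : 0 < gamma + 1 by rewrite ltr_wpDl.
have NT0 : 0 < NT by rewrite mulr_gt0.
(* A nonnegative increment forces the curvature to be at most 5 times the score; the former is
   quadratic and the latter linear in [e], and one factor [pnorm e] cancels. *)
have scaled (s : R) : 0 <= s <= 1 -> s * ((gamma + 1) * pnorm d) <= 1 ->
    NT * (s * pnorm d) <= M.
  move=> s01 sd; have /andP[s0 s1] := s01.
  set e := pscale s d.
  have eN : pnorm e = s * pnorm d by rewrite pnorm_scale ger0_norm.
  have e1 i r : `|log_odds e i r| <= 1.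
    by apply: le_trans (log_odds_le _ _ _) _; rewrite eN mulrCA.
  have h1 : loglik theta <= loglik (pshift theta e).
    by apply: log_pseudolik_concave => //; rewrite dE.
  have h2 := log_pseudolik_quad theta e1.
  have h3 := info_form_ge theta e.
  have h4 := directional_score_le theta e.
  have h5 : directional_score theta e <= `|directional_score theta e| by exact: ler_norm.
  rewrite -eN; have [->|pe] := eqVneq (pnorm e) 0.
    rewrite mulr0; apply: mulr_ge0; last exact: sqrtr_ge0.
    by apply: mulr_ge0; [rewrite mulr_ge0|exact: info_const_ge0].
  have pe0 : 0 < pnorm e by rewrite lt_def pe pnorm_ge0.
  rewrite -(ler_pM2r pe0) -mulrA -expr2 sqr_pnorm.
  apply: le_trans h3 _.
  have -> : M * pnorm e = info_const theta *
     (5 * (2 * q%:R * Num.sqrt (score_energy theta) * pnorm e)) by rewrite /M; ring.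
  by rewrite ler_wpM2l ?info_const_ge0 //; lra.
(* A short increment is used whole. A long one, shrunk to norm [(gamma + 1)^-1], would give
   [NT <= (gamma + 1) * M], against the hypothesis. *)
have [small|large] := leP ((gamma + 1) * pnorm d) 1.
  by have := scaled 1; rewrite !mul1r; apply=> //; rewrite ler01 lexx.
have s1 : ((gamma + 1) * pnorm d)^-1 <= 1 by rewrite invf_le1 ?ltW // (lt_trans ltr01).
have pd0 : 0 < (gamma + 1) * pnorm d by lra.
have /scaled : 0 <= ((gamma + 1) * pnorm d)^-1 <= 1 by rewrite s1 invr_ge0 ltW.
rewrite mulVf ?gt_eqF // => /(_ (lexx _)).
have -> : ((gamma + 1) * pnorm d)^-1 * pnorm d = (gamma + 1)^-1.
  by field; rewrite gt_eqF //= gt_eqF //; move: pd0; rewrite pmulr_rgt0.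
by rewrite ler_pdivrMr // mulrC leNgt MT.
Qed.

End PseudoLikelihood.
(** * Existence and uniqueness of the maximizer *)

Section Existence.
Context {R : realType} {q N : nat}.
Context (A : 'M[R]_N) (A_ge0 : forall i j, 0 <= A i j).
Context (gamma : R) (A_row : forall i, \sum_j A i j <= gamma) (gamma_ge0 : 0 <= gamma).
Context (q_gt0 : (0 < q)%N) (x : config q N).
Implicit Types (theta d : param R q) (i j : 'I_N) (r s : 'I_q).

Local Notation loglik := (log_pseudolik A x).

(** Orients the unordered pairs so that [i], [k] carry [r] and [j], [l] carry [s]. The two
    inequalities kept compare opposite colours in both orders, so no threshold can separate the
    colours. *)
Lemma Omega_set_witness : Omega_set A x -> exists r s i j k l,
  [/\ x i = r, x j = s, x k = r & x l = s] /\
  (field_gap A x r s i < field_gap A x r s l /\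
   field_gap A x r s j < field_gap A x r s k).
Proof.
move=> [r [s [i [j [k [l [rs _ ij kl]]]]]]].
have rsN : r != s by rewrite neq_ltn rs.
have two a b : [set x a; x b]%SET = [set r; s]%SET ->
    (x a = r /\ x b = s) \/ (x a = s /\ x b = r).
  move=> E; have : x a \in [set r; s]%SET by rewrite -E set21.
  rewrite !inE => /orP[]/eqP xa; [left|right]; split=> //.
    have : s \in [set x a; x b]%SET by rewrite E set22.
    by rewrite !inE xa eq_sym (negbTE rsN) => /eqP.
  have : r \in [set x a; x b]%SET by rewrite E set21.
  by rewrite !inE xa (negbTE rsN) => /eqP.
rewrite gt_max !lt_min => /andP[/andP[ik il] /andP[jk jl]].
exists r, s; case: (two _ _ ij) (two _ _ (esym kl)) => [[xi xj]|[xi xj]] [[xk xl]|[xk xl]].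
- by exists i, j, k, l.
- by exists i, j, l, k.
- by exists j, i, k, l.
- by exists j, i, l, k.
Qed.

(** Each site contributes the logarithm of a probability, hence a nonpositive term, so
    [- loglik theta] dominates each single contribution. *)
Lemma log_odds_le_loglik theta i r :
  log_odds A x theta i r - log_odds A x theta i (x i) <= - loglik theta.
Proof.
have lnZ k s : log_odds A x theta k s <= ln (\sum_t expR (log_odds A x theta k t)).
  rewrite -[leLHS]expRK ler_ln ?posrE ?expR_gt0 //; last exact: (partition_gt0 _ s).
  by rewrite (bigD1 s) //= lerDl; apply: sumr_ge0 => t _; exact: expR_ge0.
rewrite log_pseudolikE (bigD1 i) //= [leRHS]opprD.
rewrite -[leLHS]addr0 lerD //; first by rewrite opprB lerD2r lnZ.
by rewrite oppr_ge0; apply: sumr_le0 => k _; rewrite subr_le0.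
Qed.

Lemma continuous_log_odds i r : continuous (fun theta => log_odds A x theta i r).
Proof.
move=> theta; apply: cvgD.
  by apply: cvgM; [exact: cvg_fst|exact: cvg_cst].
rewrite /ext_field; case: insub => [k|]; last exact: cvg_cst.
apply: (@continuous_comp _ _ _ (fun th : param R q => th.2) (fun v => v ord0 k)).
  exact: cvg_snd.
exact: coord_continuous.
Qed.

Lemma continuous_log_pseudolik : continuous loglik.
Proof.
have -> : loglik = fun theta => \sum_i (log_odds A x theta i (x i)
    - ln (\sum_r expR (log_odds A x theta i r))).
  by apply/funext => theta; exact: log_pseudolikE.
apply: continuous_big => [|i _ theta]; first exact: add_continuous.
apply: cvgB; first exact: continuous_log_odds.
apply: continuous_cvg; first exact/continuous_ln/(partition_gt0 _ (Ordinal q_gt0)).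
suff : continuous (fun th => \sum_r expR (log_odds A x th i r)) by exact.
apply: continuous_big => [|r _ th]; first exact: add_continuous.
apply: continuous_cvg; first exact: continuous_expR.
exact: continuous_log_odds.
Qed.

Context (Omega_x : Omega_set A x) (Lambda_x : Lambda_set N x).

(** On a superlevel set no colour can beat the observed one by more than [|C|] in log-odds. Adding
    such bounds at [i], [l] and at [j], [k] eliminates the fields and bounds [theta.1] on both
    sides. *)
Lemma superlevel_bounded (C : R) : exists K, forall theta, - C <= loglik theta ->
  `|theta.1| <= K /\ forall r, `|ext_field theta.2 r| <= K.
Proof.
have [r [s [i [j [k [l [[xi xj xk xl] [il jk]]]]]]]] := Omega_set_witness Omega_x.
set g := field_gap A x r s in il jk.
pose K0 := 2 * `|C| / (g k - g j) + 2 * `|C| / (g l - g i).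
have kj0 : 0 < g k - g j by rewrite subr_gt0.
have li0 : 0 < g l - g i by rewrite subr_gt0.
have t1 : 0 <= 2 * `|C| / (g k - g j) by rewrite divr_ge0 ?mulr_ge0 // ltW.
have t2 : 0 <= 2 * `|C| / (g l - g i) by rewrite divr_ge0 ?mulr_ge0 // ltW.
exists (`|C| + K0 + K0 * gamma) => theta hC.
have C_le : - loglik theta <= `|C| by have := ler_norm C; lra.
have odds a t : log_odds A x theta a t - log_odds A x theta a (x a) <= `|C|.
  exact: le_trans (log_odds_le_loglik theta a t) C_le.
have uK : `|theta.1| <= K0.
  have := odds i s; have := odds j r; have := odds k s; have := odds l r.
  rewrite xi xj xk xl !log_odds_gap.
  have gN a : field_gap A x s r a = - g a by rewrite /g /field_gap opprB.
  rewrite !gN -/g; set u := theta.1; set w := ext_field _ r; set v := ext_field _ s.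
  move=> h1 h2 h3 h4.
  have a1 : - u * (g k - g j) <= 2 * `|C| by rewrite -/(g j) -/(g k) in h2 h3 *; lra.
  have a2 : u * (g l - g i) <= 2 * `|C| by rewrite -/(g l) -/(g i) in h1 h4 *; lra.
  rewrite -ler_pdivlMr // in a1; rewrite -ler_pdivlMr // in a2.
  by rewrite ler_norml /K0; lra.
have K00 : 0 <= K0 by rewrite addr_ge0.
have Kg : 0 <= K0 * gamma by rewrite mulr_ge0.
split=> [|t]; first by have := normr_ge0 C; lra.
(* A site of colour [t] and one of the last colour, compared in opposite directions, bound the field
   of [t] on both sides. *)
have [a xa] := Lambda_x t; have [b xb] := Lambda_x (last_colour q_gt0).
have := odds a (last_colour q_gt0); have := odds b t.
rewrite xa xb !log_odds_gap ext_field_last.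
have ug c p p' : `|theta.1 * field_gap A x p p' c| <= K0 * gamma.
  by rewrite normrM ler_pM // field_gap_le.
have := ug a (last_colour q_gt0) t; have := ug b t (last_colour q_gt0).
by rewrite !ler_norml; lra.
Qed.

Lemma pseudolik_has_maximizer : exists theta, maximizes_pseudolik A x theta.
Proof.
(* The level is the value at the zero parameter: every point outside the compact box [S] lies below
   it, and [S] contains [(0, 0)]. *)
have [K HK] := superlevel_bounded (- loglik (0, 0)).
pose S := (`[- K, K]%classic : set R) `*`
  [set v : 'rV[R]_(q.-1) | forall k, `[- K, K]%classic (v ord0 k)].
have inS theta : loglik (0, 0) <= loglik theta -> S theta.
  rewrite -[leLHS]opprK => /HK[h1 h2]; split; first by rewrite /= in_itv /= -ler_norml.
  by move=> k /=; rewrite in_itv /= -ler_norml -ext_field_widen.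
have cS : compact S.
  apply: compact_setX; first exact: segment_compact.
  apply: (@rV_compact _ _ (fun=> `[- K, K]%classic)) => _; exact: segment_compact.
have S0 : S !=set0 by exists (0, 0); exact: inS.
have cf : {within S, continuous loglik}.
  by apply: continuous_subspaceT; exact: continuous_log_pseudolik.
have [theta _ thmax] := compact_EVT_max S0 cS cf.
exists theta => theta'.
have [le0|lt0] := leP (loglik (0, 0)) (loglik theta').
  by apply: thmax; apply/mem_set/inS.
by apply: le_trans (ltW lt0) _; apply: thmax; apply/mem_set/inS.
Qed.

(** Identifiability: a direction that changes no conditional law is zero. [Omega_x] supplies two
    distinct gaps for one pair of colours, which forces [d.1 = 0]. *)
Lemma log_odds_balanced_eq0 d :
  (forall i r s, log_odds A x d i r = log_odds A x d i s) -> d = (0, 0).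
Proof.
move=> bal; have [r [s [i [_ [_ [l [_ [il _]]]]]]]] := Omega_set_witness Omega_x.
have gap a p p' : d.1 * field_gap A x p p' a + (ext_field d.2 p - ext_field d.2 p') = 0.
  by rewrite -log_odds_gap (bal a p p') subrr.
have d10 : d.1 = 0.
  have : d.1 * (field_gap A x r s l - field_gap A x r s i) = 0.
    by have := gap i r s; have := gap l r s; lra.
  by move/eqP; rewrite mulf_eq0 (gt_eqF (x := _ - _)) ?subr_gt0 // orbF => /eqP.
apply: (@pnorm_eq0 R q q_gt0 d d10) => p.
by apply/eqP; rewrite -subr_eq0; have := gap i p (last_colour q_gt0);
  rewrite d10 mul0r add0r => ->.
Qed.

(* At the midpoint of two maximizers the score contributions of [e] and [- e]
   cancel in the quadratic upper bound. *)
Lemma pseudolik_maximizer_unique theta1 theta2 :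
  maximizes_pseudolik A x theta1 -> maximizes_pseudolik A x theta2 -> theta1 = theta2.
Proof.
move=> m1 m2.
pose d : param R q := ((theta2.1 - theta1.1) / 2, 2^-1 *: (theta2.2 - theta1.2)).
pose m : param R q := ((theta1.1 + theta2.1) / 2, 2^-1 *: (theta1.2 + theta2.2)).
have E2 : pshift m d = theta2.
  case: theta1 theta2 @d @m {m1 m2} => [a1 b1] [a2 b2] /=; rewrite /pshift /=.
  congr pair; first by field.
  by apply/rowP => k; rewrite !mxE; field.
have E1 : pshift m (pscale (-1) d) = theta1.
  case: theta1 theta2 @d @m {m1 m2 E2} => [a1 b1] [a2 b2] /=; rewrite /pshift /=.
  congr pair; first by field.
  by apply/rowP => k; rewrite !mxE; field.
(* This [s] makes the log-odds of the increments [pscale s d] and its opposite at most 1 in absolute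
   value. *)
clearbody d m; pose s := (1 + (gamma + 1) * pnorm d)^-1.
have gd : 0 <= (gamma + 1) * pnorm d by rewrite mulr_ge0 ?pnorm_ge0 // addr_ge0.
have s0 : 0 < s by rewrite invr_gt0; lra.
have s01 : 0 <= s <= 1 by rewrite (ltW s0) invf_le1; lra.
have small i r : `|log_odds A x (pscale s d) i r| <= 1.
  apply: le_trans (log_odds_le A_ge0 A_row _ _ _ _) _.
  rewrite pnorm_scale (gtr0_norm s0) mulrCA /s mulrC ler_pdivrMr; lra.
have smallN i r : `|log_odds A x (pscale s (pscale (-1) d)) i r| <= 1.
  by have := small i r; rewrite !log_odds_scale mulN1r mulrN normrN.
have h1 : loglik m <= loglik (pshift m (pscale s d)).
  by apply: log_pseudolik_concave => //; rewrite E2; exact: m2.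
have h2 : loglik m <= loglik (pshift m (pscale s (pscale (-1) d))).
  by apply: log_pseudolik_concave => //; rewrite E1; exact: m1.
have q1 := log_pseudolik_quad q_gt0 m small.
have q2 := log_pseudolik_quad q_gt0 m smallN.
rewrite !directional_score_scale in q1 q2.
rewrite !info_form_scale in q1 q2.
have infoN : info_form A x m d <= 0.
  rewrite -(pmulr_rle0 _ (exprn_gt0 2 s0)).
  by move: (info_form _ _ _ _) (directional_score _ _ _ _) q1 q2 => I S; lra.
have d0 : d = (0, 0).
  apply: log_odds_balanced_eq0 => i r t.
  have := info_form_ge_pair A_ge0 A_row q_gt0 x m d r t.
  move=> /le_trans/(_ infoN); rewrite pmulr_rle0; last first.
    by apply: divr_gt0 => //; exact: cond_prob_floor_gt0.
  rewrite (bigD1 i) //= => le0; apply/eqP; rewrite -subr_eq0 -sqrf_eq0 eq_le sqr_ge0 andbT.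
  apply: le_trans le0; rewrite lerDl; apply: sumr_ge0 => k _; exact: sqr_ge0.
transitivity (pshift m (pscale (-1) d)) => //; rewrite -[RHS]E2.
by rewrite d0 /pscale /= mulr0 scaler0.
Qed.

Lemma MPL_exists_of_Omega_Lambda : MPL_exists A x.
Proof.
have [theta thmax] := pseudolik_has_maximizer.
by exists theta; split=> // theta' ?; exact: pseudolik_maximizer_unique.
Qed.

End Existence.
(** * Configurations outside Omega *)

Section Dichotomy.
Context {R : realType} {q N : nat}.
Context (A : 'M[R]_N) (A_ge0 : forall i j, 0 <= A i j).
Context (gamma : R) (A_row : forall i, \sum_j A i j <= gamma) (gamma_ge0 : 0 <= gamma).
Context (q_gt0 : (0 < q)%N) (theta : param R q).
Implicit Types (x : config q N) (i j : 'I_N) (r s : 'I_q).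

Local Notation p x := (cond_prob A theta x).
Local Notation c := (cond_prob_floor gamma theta).

Definition gap_stat r s k x i : R := field_gap A x r s i ^+ k.
Definition gap_prob_stat r s k x i : R := gap_stat r s k x i * p x i s.

(** Powers 0, 1, 2 are those in the expansion of [(g - t) ^+ 2]. The threshold [t] stays outside the
    scores as a coefficient, so it may depend on the configuration. *)
Definition gap_energy x : R := \sum_r \sum_s \sum_(k < 3)
  (score A theta (gap_stat r s k) r x ^+ 2
   + score A theta (gap_prob_stat r s k) r x ^+ 2).

Lemma gap_energy_ge x r s k : (k < 3)%N ->
  score A theta (gap_stat r s k) r x ^+ 2
   + score A theta (gap_prob_stat r s k) r x ^+ 2 <= gap_energy x.
Proof.
move=> k3; rewrite /gap_energy.
set G := fun r' s' (k' : nat) => score A theta (gap_stat r' s' k') r' x ^+ 2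
   + score A theta (gap_prob_stat r' s' k') r' x ^+ 2.
have G0 r' s' k' : 0 <= G r' s' k' by rewrite addr_ge0 ?sqr_ge0.
rewrite (bigD1 r) //= (bigD1 s) //= (bigD1 (Ordinal k3)) //= -/(G r s k).
rewrite -[leLHS]addr0 lerD //; last by do 3! [apply: sumr_ge0 => ? _]; exact: G0.
rewrite -[leLHS]addr0 lerD //; last by do 2! [apply: sumr_ge0 => ? _]; exact: G0.
by rewrite lerDl; apply: sumr_ge0 => ? _; exact: G0.
Qed.

Lemma score_gap_le x r s k : (k < 3)%N ->
  `|score A theta (gap_stat r s k) r x| <= Num.sqrt (gap_energy x).
Proof.
move=> k3; have h := gap_energy_ge x r s k3.
rewrite -sqrtr_sqr ler_sqrt; first by apply: le_trans h; rewrite lerDl sqr_ge0.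
by apply: le_trans h; rewrite addr_ge0 ?sqr_ge0.
Qed.

Lemma score_gap_prob_le x r s k : (k < 3)%N ->
  `|score A theta (gap_prob_stat r s k) r x| <= Num.sqrt (gap_energy x).
Proof.
move=> k3; have h := gap_energy_ge x r s k3.
rewrite -sqrtr_sqr ler_sqrt; first by apply: le_trans h; rewrite lerDr sqr_ge0.
by apply: le_trans h; rewrite addr_ge0 ?sqr_ge0.
Qed.

Lemma field_gap_swap x r s i : field_gap A x s r i = - field_gap A x r s i.
Proof. by rewrite /field_gap opprB. Qed.

Context (N_gt0 : (0 < N)%N) (x : config q N).
Local Notation g r s i := (field_gap A x r s i).
Local Notation E := (Num.sqrt (gap_energy x)).

(** The variance is at most the mean squared deviation from any [t], and the floor [c] allows
    weighting the sites by [cond_prob] of colour [r]. Replacing these weights by indicators costs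
    scores with coefficients 1, [2 * t], [t ^+ 2], in all [(1 + gamma) ^+ 2 * E]. *)
Lemma gap_var_le_spread r s (t b : R) : `|t| <= gamma ->
  \sum_i (g r s i - t) ^+ 2 * (x i == r)%:R <= b ->
  c * (N%:R * gap_var A x r s) <= b + (1 + gamma) ^+ 2 * E.
Proof.
move=> tg hb.
have c0 := cond_prob_floor_gt0 gamma q_gt0 theta.
have E0 : 0 <= E by exact: sqrtr_ge0.
have h1 : c * (N%:R * gap_var A x r s) <= \sum_i (g r s i - t) ^+ 2 * p x i r.
  apply: (@le_trans _ _ (\sum_i c * (1 * g r s i + - t) ^+ 2)).
    rewrite -mulr_sumr sum_affine_gap // expr1n !mul1r.
    by rewrite !ler_wpM2l ?(ltW c0) // lerDl sqr_ge0.
  apply: ler_sum => i _; rewrite mul1r mulrC ler_wpM2l ?sqr_ge0 //.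
  exact: cond_prob_floor_le.
have h2 : \sum_i (g r s i - t) ^+ 2 * p x i r
   = \sum_i (g r s i - t) ^+ 2 * (x i == r)%:R
     - (score A theta (gap_stat r s 2) r x - 2 * t * score A theta (gap_stat r s 1) r x
        + t ^+ 2 * score A theta (gap_stat r s 0) r x).
  rewrite /score !mulr_sumr -sumrB -big_split -sumrB; apply: eq_bigr => i _ /=.
  by rewrite /gap_stat /colour_resid; ring.
apply: le_trans h1 _; rewrite h2 lerD //.
have s2 := @score_gap_le x r s 2 isT; have s1 := @score_gap_le x r s 1 isT.
have s0 := @score_gap_le x r s 0 isT.
apply: le_trans (ler_norm _) _; rewrite normrN.
apply: le_trans (ler_normD _ _) _.
have t1 : `|2 * t * score A theta (gap_stat r s 1) r x| <= 2 * gamma * E.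
  by rewrite normrM ler_pM // normrM ger0_norm // ler_wpM2l.
have t2 : `|t ^+ 2 * score A theta (gap_stat r s 0) r x| <= gamma ^+ 2 * E.
  by rewrite normrM ler_pM // normrX lerXn2r ?nnegrE.
have := ler_normB (score A theta (gap_stat r s 2) r x)
  (2 * t * score A theta (gap_stat r s 1) r x).
by lra.
Qed.

(* [(g - t) (1_r p_s - 1_s p_r)] has conditional mean zero, and a constant sign when
   [t] separates the two colours. *)
Lemma spread_le_of_separated r s (t e : R) : r != s -> `|t| <= gamma -> `|e| = 1 ->
  (forall i, x i = r -> 0 <= e * (g r s i - t)) ->
  (forall i, x i = s -> e * (g r s i - t) <= 0) ->
  \sum_i (g r s i - t) ^+ 2 * (x i == r)%:R
  <= 4 * gamma * (1 + gamma) / c * E.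
Proof.
move=> rs tg e1 hr hs.
have c0 := cond_prob_floor_gt0 gamma q_gt0 theta.
have E0 : 0 <= E by exact: sqrtr_ge0.
pose F i := (g r s i - t) * ((x i == r)%:R * p x i s - (x i == s)%:R * p x i r).
have Fle : `|\sum_i F i| <= 2 * (1 + gamma) * E.
  (* The products of the two conditional probabilities cancel between the orders [(r, s)] and
     [(s, r)]; [field_gap_swap] accounts for the change of sign. *)
  have -> : \sum_i F i
     = (score A theta (gap_prob_stat r s 1) r x - t * score A theta (gap_prob_stat r s 0) r x)
     + (score A theta (gap_prob_stat s r 1) s x + t * score A theta (gap_prob_stat s r 0) s x).
    rewrite /score !mulr_sumr -sumrB -!big_split; apply: eq_bigr => i _ /=.
    by rewrite /F /gap_prob_stat /gap_stat /colour_resid field_gap_swap; ring.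
  have a1 := @score_gap_prob_le x r s 1 isT; have a0 := @score_gap_prob_le x r s 0 isT.
  have b1 := @score_gap_prob_le x s r 1 isT; have b0 := @score_gap_prob_le x s r 0 isT.
  have ta0 : `|t * score A theta (gap_prob_stat r s 0) r x| <= gamma * E.
    by rewrite normrM ler_pM.
  have tb0 : `|t * score A theta (gap_prob_stat s r 0) s x| <= gamma * E.
    by rewrite normrM ler_pM.
  by move: a1 ta0 b1 tb0; rewrite !ler_norml; lra.
(* At colour [r], [w = e * (g - t)] lies in [[0, 2 * gamma]], so its square is at most
   [2 * gamma * w]; at colour [s] the right side is nonnegative. *)
have term i : c * ((g r s i - t) ^+ 2 * (x i == r)%:R) <= 2 * gamma * (e * F i).
  rewrite /F; have [xr|xr] := eqVneq (x i) r.
    rewrite xr (negbTE rs) mulr0n mul0r subr0 mulr1 mul1r.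
    have ps := cond_prob_floor_le A_ge0 A_row q_gt0 x theta i s.
    have h0 := hr i xr; set y := g r s i - t in h0 *.
    have y2 : y ^+ 2 = (e * y) ^+ 2.
      by rewrite exprMn -(real_normK (num_real e)) e1 expr1n mul1r.
    have yg : e * y <= 2 * gamma.
      apply: le_trans (ler_norm _) _; rewrite normrM e1 mul1r.
      apply: le_trans (ler_normB _ _) _.
      by have := field_gap_le A_ge0 A_row x i r s; lra.
    rewrite y2 [leRHS](_ : _ = p x i s * (2 * gamma * (e * y))); last by ring.
    set w := e * y in h0 yg *.
    apply: ler_pM => //; [exact: ltW|exact: sqr_ge0|by rewrite expr2 ler_wpM2r].
  rewrite mulr0n mulr0 mulr0 mul0r sub0r.
  have [xs|_] := eqVneq (x i) s; last by rewrite mulr0n mul0r oppr0 !mulr0.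
  rewrite mul1r [leRHS](_ : _ = 2 * gamma * (- (e * (g r s i - t)) * p x i r)); last by ring.
  apply: mulr_ge0; first by rewrite mulr_ge0.
  by apply: mulr_ge0; [rewrite oppr_ge0 hs|exact/ltW/cond_prob_gt0].
have cX : c * \sum_i (g r s i - t) ^+ 2 * (x i == r)%:R <= 2 * gamma * (2 * (1 + gamma) * E).
  rewrite mulr_sumr; apply: le_trans (ler_sum _ (fun i _ => term i)) _.
  rewrite -!mulr_sumr ler_wpM2l ?mulr_ge0 //.
  by apply: le_trans (ler_norm _) _; rewrite normrM e1 mul1r.
rewrite mulrAC ler_pdivlMr // mulrC; apply: le_trans cX _.
by rewrite le_eqVlt; apply/orP; left; apply/eqP; ring.
Qed.

Lemma gap_var_swap r s : gap_var A x s r = gap_var A x r s.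
Proof.
rewrite /gap_var /gap_mean; congr (_ * _ - _); last by ring.
by apply: eq_bigr => i _; ring.
Qed.

Definition dichotomy_const : R :=
  (4 * gamma * (1 + gamma) / c + (1 + gamma) ^+ 2) / c.

Lemma dichotomy_const_ge0 : 0 <= dichotomy_const.
Proof.
have c0 := ltW (cond_prob_floor_gt0 gamma q_gt0 theta).
apply: divr_ge0 => //; apply: addr_ge0; last exact: sqr_ge0.
by apply: divr_ge0 => //; apply: mulr_ge0; [rewrite mulr_ge0|rewrite addr_ge0].
Qed.

(* If a pair of colours does not witness membership in Omega, then the ranges of the
   gaps over the two colours meet in at most one point. *)
Lemma gap_var_le_of_notOmega r s : Lambda_set N x -> ~ Omega_set A x -> (r < s)%N ->
  N%:R * gap_var A x r s <= dichotomy_const * E.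
Proof.
move=> Lx nOx rs; have rsN : r != s by rewrite neq_ltn rs.
have c0 := cond_prob_floor_gt0 gamma q_gt0 theta.
have E0 : 0 <= E by exact: sqrtr_ge0.
have tg i : `|g r s i| <= gamma by exact: field_gap_le.
pose K := 4 * gamma * (1 + gamma) / c.
have K0 : 0 <= K.
  apply: divr_ge0; last exact: ltW.
  by apply: mulr_ge0; [rewrite mulr_ge0|rewrite addr_ge0].
suff main : c * (N%:R * gap_var A x r s) <= K * E + (1 + gamma) ^+ 2 * E.
  rewrite /dichotomy_const -/K mulrAC ler_pdivlMr // mulrC.
  by apply: le_trans main _; rewrite mulrDl.
have [i0 xi0] := Lx r; have [j0 xj0] := Lx s.
(* [a], [b] attain the least and greatest gap over colour [r], and [a'], [b'] over colour [s]. *)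
have [a /eqP xa amin] := @arg_minP _ R _ i0 (fun i => x i == r) (fun i => g r s i) (introT eqP xi0).
have [b /eqP xb bmax] := @arg_maxP _ R _ i0 (fun i => x i == r) (fun i => g r s i) (introT eqP xi0).
have [a' /eqP xa' a'min] := @arg_minP _ R _ j0 (fun i => x i == s) (fun i => g r s i) (introT eqP xj0).
have [b' /eqP xb' b'max] := @arg_maxP _ R _ j0 (fun i => x i == s) (fun i => g r s i) (introT eqP xj0).
have {}amin i : x i = r -> g r s a <= g r s i by move=> xi; apply: amin; rewrite xi.
have {}bmax i : x i = r -> g r s i <= g r s b by move=> xi; apply: bmax; rewrite xi.
have {}a'min i : x i = s -> g r s a' <= g r s i by move=> xi; apply: a'min; rewrite xi.
have {}b'max i : x i = s -> g r s i <= g r s b' by move=> xi; apply: b'max; rewrite xi.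
have KE : 0 <= K * E by rewrite mulr_ge0.
(* The gap is constant on colour [r]: at this threshold the spread vanishes. The next case is the
   same for colour [s], with the sign of the gap reversed. *)
have [ba|ab] := leP (g r s b) (g r s a).
  apply: (@gap_var_le_spread r s (g r s a)) => //; rewrite big1 // => i _.
  have [xi|_] := eqVneq (x i) r; last by rewrite mulr0.
  have -> : g r s i = g r s a.
    apply/eqP; rewrite eq_le amin // andbT (le_trans _ ba) //.
    by apply: bmax.
  by rewrite subrr expr0n mul0r.
have [b'a'|a'b'] := leP (g r s b') (g r s a').
  rewrite -gap_var_swap.
  apply: (@gap_var_le_spread s r (- g r s a')); rewrite ?normrN // big1 // => i _.
  have [xi|_] := eqVneq (x i) s; last by rewrite mulr0.
  rewrite field_gap_swap; have -> : g r s i = g r s a'.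
    apply/eqP; rewrite eq_le a'min // andbT (le_trans _ b'a') //.
    by apply: b'max.
  by rewrite subrr expr0n mul0r.
(* Colour [r] lies above colour [s], so [e = 1]; in the case after this it lies below, so
   [e = -1]. *)
have [b'a|ab'] := leP (g r s b') (g r s a).
  apply: (@gap_var_le_spread r s (g r s a)) => //.
  apply: (@spread_le_of_separated r s _ 1) => //; first by rewrite normr1.
    by move=> i xi; rewrite mul1r subr_ge0 amin.
  by move=> i xi; rewrite mul1r subr_le0 (le_trans _ b'a) // b'max.
have [ba'|a'b] := leP (g r s b) (g r s a').
  apply: (@gap_var_le_spread r s (g r s a')) => //.
  apply: (@spread_le_of_separated r s _ (-1)) => //; first by rewrite normrN1.
    by move=> i xi; rewrite mulN1r oppr_ge0 subr_le0 (le_trans _ ba') // bmax.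
  by move=> i xi; rewrite mulN1r oppr_le0 subr_ge0 a'min.
(* Both ranges are now nondegenerate and overlap in an interval of positive length, so the
   minimizers and maximizers are the four indices required by [Omega_set]. *)
case: nOx; exists r, s, a, a', b, b'; split=> //.
- have ne k l : g r s k < g r s l -> k != l.
    by move=> kl; apply: contraTneq kl => ->; rewrite ltxx.
  have nc k l : x k = r -> x l = s -> k != l.
    by move=> xk xl; apply: contraNneq rsN => kl; rewrite -xk -xl kl.
  by rewrite /= !inE !negb_or !andbT (nc a a') // (nc b b') // !ne.
- by rewrite xa xa'.
- by rewrite xb xb'.
- by rewrite gt_max !lt_min ab ab' a'b a'b'.
Qed.

Lemma T_stat_le_of_notOmega : Lambda_set N x -> ~ Omega_set A x ->
  N%:R * T_stat A x <= q%:R ^+ 2 * (dichotomy_const * E).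
Proof.
move=> Lx nOx; have NR : 0 < N%:R :> R by rewrite ltr0n.
have M0 : 0 <= dichotomy_const * E / N%:R.
  by rewrite divr_ge0 // mulr_ge0 ?sqrtr_ge0 // dichotomy_const_ge0.
have : T_stat A x <= q%:R ^+ 2 * (dichotomy_const * E / N%:R).
  apply: T_stat_le_pairs => // r s rs.
  by rewrite ler_pdivlMr // mulrC gap_var_le_of_notOmega.
by rewrite mulrA ler_pdivlMr // mulrC.
Qed.

End Dichotomy.
(** * Tightness and the limit *)

Section Energy.
Context {R : realType} {q N : nat}.
Context (A : 'M[R]_N) (A_sym : A^T = A) (A_diag : forall i, A i i = 0).
Context (A_ge0 : forall i j, 0 <= A i j).
Context (gamma : R) (A_row : forall i, \sum_j A i j <= gamma) (gamma_ge0 : 0 <= gamma).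
Context (q_gt0 : (0 < q)%N) (theta : param R q).
Implicit Types (x : config q N) (r s : 'I_q).

(** For an absent colour every residual is at most minus the floor, so the score with [h = 1] has
    order [N] rather than its typical order [sqrt N]. *)
Lemma score_energy_lower x : (0 < N)%N -> ~ Lambda_set N x ->
  (cond_prob_floor gamma theta * N%:R) ^+ 2 <= score_energy A x theta.
Proof.
move=> N0 /existsNP[r /forallNP noR].
have c0 := cond_prob_floor_gt0 gamma q_gt0 theta.
rewrite /score_energy (bigD1 r) //=.
set S1 := score A theta (fun _ _ => 1) r x.
have hS : cond_prob_floor gamma theta * N%:R <= - S1.
  rewrite -sumrN mulr_natr -[N in leLHS]card_ord -sumr_const; apply: ler_sum => i _.
  rewrite /colour_resid mul1r; have /eqP/negbTE-> := noR i.
  by rewrite sub0r opprK cond_prob_floor_le.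
have : (cond_prob_floor gamma theta * N%:R) ^+ 2 <= (- S1) ^+ 2.
  have p0 : 0 <= cond_prob_floor gamma theta * N%:R by rewrite mulr_ge0 // ltW.
  by rewrite lerXn2r ?nnegrE // (le_trans p0).
rewrite sqrrN => /le_trans; apply; rewrite addrAC lerDr addr_ge0 ?sqr_ge0 //.
by apply: sumr_ge0 => s _; rewrite addr_ge0 ?sqr_ge0.
Qed.

Definition energy x : R := score_energy A x theta + gap_energy A theta x.

Lemma score_energy_ge0 x : 0 <= score_energy A x theta.
Proof. by apply: sumr_ge0 => r _; rewrite addr_ge0 ?sqr_ge0. Qed.

Lemma gap_energy_ge0 x : 0 <= gap_energy A theta x.
Proof. by do 3! [apply: sumr_ge0 => ? _]; rewrite addr_ge0 ?sqr_ge0. Qed.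

Lemma energy_ge0 x : 0 <= energy x.
Proof. by rewrite addr_ge0 ?score_energy_ge0 ?gap_energy_ge0. Qed.

Definition moment_const (C L : R) : R := C ^+ 2 + C * (L + 2 * `|theta.1| * C) * gamma.

(** Product rule, by induction on [k]; at [k = 0] the truncated exponent [k.-1] is multiplied by
    [k%:R = 0]. *)
Lemma local_stat_gapX r s k :
  local_stat A (gamma ^+ k) (2 * k%:R * gamma ^+ k.-1) (gap_stat A r s k).
Proof.
have hg := local_stat_gap A_sym A_ge0 A_row r s gamma_ge0.
elim: k => [|k IHk].
  by rewrite mulr0 mul0r expr0 -[X in local_stat _ X]normr1; exact: local_stat_cst.
have := local_statM IHk hg.
have -> : gamma ^+ k * 2 + gamma * (2 * k%:R * gamma ^+ k.-1)
    = 2 * k.+1%:R * gamma ^+ k.+1.-1.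
  by case: k {IHk} => [|k] /=; rewrite ?expr0 -?[k.+2]addn1 ?natrD ?exprS; ring.
by rewrite -exprSr (_ : (fun x i => _) = gap_stat A r s k.+1) //;
  apply/funext => x; apply/funext => i; rewrite /gap_stat exprSr.
Qed.

Definition energy_const : R :=
  \sum_(r < q) (moment_const gamma 1 + moment_const 1 0)
  + \sum_(r < q) \sum_(s < q) \sum_(k < 3)
     (moment_const (gamma ^+ k) (2 * k%:R * gamma ^+ k.-1)
      + moment_const (gamma ^+ k * 1)
          (gamma ^+ k * (2 * `|theta.1|) + 1 * (2 * k%:R * gamma ^+ k.-1))).

Lemma energy_mean : potts_mean A theta energy <= N%:R * energy_const.
Proof.
have second C L h r : local_stat A C L h ->
    potts_mean A theta (fun x => score A theta h r x ^+ 2) <= N%:R * moment_const C L.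
  exact: score_second_moment.
rewrite /energy potts_meanD mulrDr lerD //.
  rewrite /score_energy potts_mean_sum mulr_sumr; apply: ler_sum => r _.
  rewrite potts_meanD mulrDr lerD //; apply: second.
    exact: local_stat_field.
  by rewrite -[X in local_stat _ X]normr1; exact: local_stat_cst.
rewrite /gap_energy potts_mean_sum mulr_sumr; apply: ler_sum => r _.
rewrite potts_mean_sum mulr_sumr; apply: ler_sum => s _.
rewrite potts_mean_sum mulr_sumr; apply: ler_sum => k _.
rewrite potts_meanD mulrDr lerD //; apply: second; first exact: local_stat_gapX.
by apply: local_statM; [exact: local_stat_gapX|exact: local_stat_prob].
Qed.

End Energy.

(** Markov's inequality with [energy_mean]. [K] is chosen before [N] and [A], and [|M| + 1] makes it
    positive. *)
Lemma energy_tight (R : realType) (q : nat) (gamma : R) (theta : param R q) (eps : R) :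
  (0 < q)%N -> 0 <= gamma -> 0 < eps -> exists2 K, 0 < K &
  forall (N : nat) (A : 'M[R]_N), A^T = A -> (forall i, A i i = 0) ->
    (forall i j, 0 <= A i j) -> (forall i, \sum_j A i j <= gamma) -> (0 < N)%N ->
    potts_prob A theta [set x | K * N%:R < energy A theta x] <= eps.
Proof.
move=> q0 g0 e0; set M := energy_const gamma theta.
have K0 : 0 < (`|M| + 1) / eps by rewrite divr_gt0 // ltr_wpDl.
exists ((`|M| + 1) / eps) => // N A A_sym A_diag A_ge0 A_row N0.
have NR : 0 < N%:R :> R by rewrite ltr0n.
apply: le_trans (potts_markov A theta q0 _ (energy_ge0 A theta)) _.
  exact: mulr_gt0.
rewrite ler_pdivrMr; last exact: mulr_gt0.
rewrite [leRHS](_ : _ = (`|M| + 1) * N%:R); last by field; rewrite gt_eqF.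
apply: le_trans (energy_mean A_sym A_diag A_ge0 A_row g0 q0 theta) _.
rewrite mulrC; apply: ler_wpM2r; first exact: ltW.
by apply: le_trans (ler_norm _) _; rewrite lerDl.
Qed.

(** * Order symbols and limits in probability *)

Section StochasticOrder.
Context {R : realType}.
Implicit Types (T d K : R) (N : nat).

Lemma near_sqrt_gt (a : R) : \forall N \near \oo, a < Num.sqrt (N%:R : R).
Proof.
near=> N; apply: le_lt_trans (ler_norm a) _; rewrite -sqrtr_sqr ltr_sqrt.
  near: N; exact: nbhs_infty_gtr.
by rewrite ltr0n; near: N; exact: nbhs_infty_gt.
Unshelve. all: by end_near. Qed.

Lemma cvg_to1P (u : nat -> R) : (forall N, u N <= 1) ->
  (u N @[N --> \oo] --> (1 : R)) <->
  (forall eps, 0 < eps -> \forall N \near \oo, 1 - u N <= eps).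
Proof.
move=> u1; split=> [/cvgrPdist_le h eps e0|h].
  by apply: filterS (h eps e0) => N; rewrite ger0_norm ?subr_ge0.
apply/cvgrPdist_le => eps e0.
by apply: filterS (h eps e0) => N; rewrite ger0_norm ?subr_ge0.
Qed.

(** At [T = 0] the ratio is [+oo] and exceeds every [K], so outside the event [T] is positive and
    the bound can be stated in the reals. *)
Lemma inve_ratio_small T (a K : R) : 0 <= T -> 0 < a ->
  ~ (K%:E < `|(T%:E^-1)%E / a%:E|)%E -> 0 < T /\ 1 <= K * (a * T).
Proof.
move=> T0 a0; rewrite [in (a%:E)^-1%E]inver gt_eqF // inver; case: eqVneq => [_|Tn].
  by rewrite mulyr gtr0_sg ?invr_gt0 // mul1e /= ltry.
have T1 : 0 < T by rewrite lt_def Tn.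
move=> /negP; rewrite -EFinM /= lte_fin -leNgt => h; split=> //.
rewrite ger0_norm in h; last by rewrite mulr_ge0 ?invr_ge0 // ltW.
have := ler_wpM2r (mulr_ge0 (ltW a0) T0) h.
by rewrite (_ : _ * _ * _ = 1) //; field; rewrite !gt_eqF.
Qed.

Lemma ratio_inve_gt d (a K : R) : 0 <= d -> 0 < a ->
  (K%:E < `|d%:E / (a%:E^-1)%E|)%E -> K < d * a.
Proof.
move=> d0 a0; rewrite inver gt_eqF // inver gt_eqF ?invr_gt0 // invrK -EFinM /= lte_fin.
by rewrite ger0_norm // mulr_ge0 // ltW.
Qed.

End StochasticOrder.

(** * Proof of the three assertions *)

Lemma ereal_sup_real_bound (R : realType) (S : set (\bar R)) :
  (ereal_sup S < +oo)%E -> exists2 g : R, 0 <= g & forall t : R, S t%:E -> t <= g.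
Proof.
move=> hs; have ub t : S t%:E -> (t%:E <= ereal_sup S)%E by move=> ?; exact: ereal_sup_ubound.
case: (ereal_sup S) hs ub => [g| |] // _ ub.
  exists `|g| => // t /ub; rewrite lee_fin => /le_trans; apply; exact: ler_norm.
(* A supremum equal to [-oo] leaves no real member, and any bound will do. *)
by exists 0 => // t /ub; rewrite leeNy_eq.
Qed.

Theorem theorem1p1 (R : realType) (q : nat) (hq : (2 <= q)%N)
  (A : forall N : nat, 'M[R]_N)
  (A_sym : forall N : nat, (A N)^T = A N)
  (A_diag : forall (N : nat) (i : 'I_N), A N i i = 0)
  (A_ge0 : forall (N : nat) (i j : 'I_N), 0 <= A N i j)
  (A_rowsum : (ereal_sup [set t : \bar R | exists (N : nat) (i : 'I_N),
                 t = (\sum_(j < N) A N i j)%:E] < +oo)%E)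
  (A_liminf : (0 < limn_einf (fun N : nat =>
                 (N%:R^-1 * \sum_(i < N) \sum_(j < N) A N i j)%:E))%E)
  (beta : R) (beta_gt0 : 0 < beta) (B : 'rV[R]_(q.-1))
  (thetahat : forall N : nat, config q N -> param R q)
  (thetahat_MPL : is_MPL_estimator A thetahat) :
  let P := fun (N : nat) (E : set (config q N)) =>
             potts_prob (A N) (beta, B) E in
  let err := fun (N : nat) (x : config q N) =>
               (l2_dist (thetahat N x) (beta, B))%:E in
  [/\ (* (a) *)
      forall (N : nat) (x : config q N),
        x \in Omega_set (A N) `&` Lambda_set N -> MPL_exists (A N) x,
      (* (b) *)
      littleo_P P (fun N x => T_inv (A N) x)
                  (fun N _ => (Num.sqrt N%:R)%:E) ->
      P N [set x | MPL_exists (A N) x] @[N --> \oo] --> (1 : R) ->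
      bigO_P P err
        (fun N x => (((Num.sqrt N%:R * T_stat (A N) x)%:E)^-1)%E) &
      (* (c) *)
      bigO_P P (fun N x => T_inv (A N) x) (fun _ _ => 1%E) ->
      [/\ P N (Omega_set (A N) `&` Lambda_set N) @[N --> \oo] --> (1 : R),
          P N [set x | MPL_exists (A N) x] @[N --> \oo] --> (1 : R) &
          bigO_P P err (fun N _ => (((Num.sqrt N%:R)%:E)^-1)%E)]].

Proof.
move=> P err.
have q0 : (0 < q)%N by exact: ltnW.
have [g g0 rowg] := ereal_sup_real_bound A_rowsum.
have {}rowg N i : \sum_j A N i j <= g by apply: rowg; exists N, i.
set theta : param R q := (beta, B).
have part_a N (x : config q N) : x \in Omega_set (A N) `&` Lambda_set N -> MPL_exists (A N) x.
  by move=> /set_mem[Ox Lx]; exact: (MPL_exists_of_Omega_Lambda (@A_ge0 N) (rowg N)).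
have P_le1 N E : P N E <= 1 by exact: potts_prob_le1.
have PC N E : 1 - P N E = P N (~` E) by rewrite /P potts_probC.
have PU N E F : P N (E `|` F) <= P N E + P N F by exact: potts_probU.
have Pmono N E F : E `<=` F -> P N E <= P N F by exact: le_potts_prob.
have tight (eps : R) : 0 < eps -> exists2 K : R, 0 < K & forall N, (0 < N)%N ->
    P N [set x | K * N%:R < energy (A N) theta x] <= eps.
  move=> e0; have [K K0 HK] := energy_tight theta q0 g0 e0.
  by exists K => // N N0; apply: HK.
pose a (K : R) := 10 * q%:R * info_const g theta * Num.sqrt K.
have a0 K : 0 <= a K.
  apply: mulr_ge0; last exact: sqrtr_ge0.
  by apply: mulr_ge0; [rewrite mulr_ge0|exact: info_const_ge0].
have g1 : 0 < g + 1 by rewrite ltr_wpDl.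
(* This is [maximizer_in_ball] on the event that the energy is at most [K * N%:R], with one factor
   [sqrt N] divided out. *)
have local_bound N (x : config q N) (K : R) : (0 < N)%N -> 0 < K ->
    energy (A N) theta x <= K * N%:R -> MPL_exists (A N) x -> 0 < T_stat (A N) x ->
    (g + 1) * a K < Num.sqrt N%:R * T_stat (A N) x ->
    Num.sqrt N%:R * T_stat (A N) x * l2_dist (thetahat N x) theta <= a K.
  move=> N0 K0 hE hM T0 hT.
  have NR : 0 < N%:R :> R by rewrite ltr0n.
  set s := Num.sqrt (N%:R : R) in hT *.
  have sN0 : 0 < s by rewrite sqrtr_gt0.
  have NN : N%:R = s * s by rewrite -expr2 sqr_sqrtr // ltW.
  have sE : 10 * q%:R * info_const g theta * Num.sqrt (score_energy (A N) x theta)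
      <= a K * s.
    rewrite /a -[leRHS]mulrA; apply: ler_wpM2l.
      by apply: mulr_ge0; [rewrite mulr_ge0|exact: info_const_ge0].
    rewrite -sqrtrM ?(ltW K0) // ler_sqrt; last by rewrite mulr_ge0 // ltW.
    by apply: le_trans hE; rewrite lerDl gap_energy_ge0.
  have ball : (g + 1) * (10 * q%:R * info_const g theta
      * Num.sqrt (score_energy (A N) x theta)) < N%:R * T_stat (A N) x.
    apply: le_lt_trans (ler_wpM2l (ltW g1) sE) _.
    by rewrite mulrA mulrC NN -mulrA ltr_pM2l.
  have := maximizer_in_ball (@A_ge0 N) (rowg N) g0 q0 N0 (thetahat_MPL _ _ hM) T0 ball.
  move=> /le_trans/(_ sE); rewrite NN [leRHS]mulrC -!mulrA.
  by rewrite ler_pM2l // mulrA.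
have T_ge0 N (x : config q N) : (0 < N)%N -> 0 <= T_stat (A N) x by exact: T_stat_ge0.
have d_ge0 (u v : param R q) : 0 <= l2_dist u v by exact: sqrtr_ge0.
split => //.
- move=> hT hM eps e0.
  have e3 : 0 < eps / 3 by rewrite divr_gt0.
  have [K K0 hK] := tight _ e3.
  (* Outside the event for [T_inv], [sqrt N * T] is at least [del^-1], which strictly exceeds the
     threshold [(g + 1) * a K] of [local_bound]. *)
  pose del := ((g + 1) * a K + 1)^-1.
  have gaK : 0 <= (g + 1) * a K by apply: mulr_ge0 => //; exact: ltW.
  have del0 : 0 < del by rewrite invr_gt0 ltr_wpDl.
  have {}hM := (cvg_to1P (fun N => P_le1 N _)).1 hM _ e3.
  have {}hT : \forall N \near \oo,
      P N [set x | del%:E < `|T_inv (A N) x / (Num.sqrt N%:R)%:E|]%E <= eps / 3.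
    move: (hT del del0) => /cvgrPdist_le/(_ _ e3); apply: filterS => N.
    by rewrite sub0r normrN => /(le_trans (ler_norm _)).
  exists (a K); near=> N.
  have N0 : (0 < N)%N by near: N; exact: nbhs_infty_gt.
  have sN0 : 0 < Num.sqrt (N%:R : R) by rewrite sqrtr_gt0 ltr0n.
  apply: (@le_trans _ _ (P N ([set x | K * N%:R < energy (A N) theta x]
     `|` (~` [set x | MPL_exists (A N) x]
     `|` [set x | del%:E < `|T_inv (A N) x / (Num.sqrt N%:R)%:E|]%E)))).
    apply: Pmono => x /= big; apply: contrapT.
    move=> /not_orP[/negP]; rewrite -leNgt => hE /not_orP[/contrapT hex hTx].
    have [T0 T1] := inve_ratio_small (T_ge0 _ x N0) sN0 hTx.
    have sT : 0 < Num.sqrt N%:R * T_stat (A N) x by rewrite mulr_gt0.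
    have := ratio_inve_gt (d_ge0 _ _) sT big.
    rewrite mulrC ltNge local_bound //.
    have : del^-1 <= Num.sqrt N%:R * T_stat (A N) x.
      by rewrite -[leLHS]mulr1 mulrC ler_pdivrMr // mulrC.
    by rewrite invrK => /(lt_le_trans _); apply; rewrite ltrDl.
  apply: le_trans (PU _ _ _) _.
  rewrite [leRHS](_ : _ = eps / 3 + (eps / 3 + eps / 3)); last by field.
  apply: lerD; first exact: hK.
  apply: le_trans (PU _ _ _) _; apply: lerD; first by rewrite -PC; near: N.
  by near: N.
move=> hT.
(* The good event for (c): [T] is bounded below by [K'^-1] and the energy has order [N]. The maximum
   with 1 below keeps [K'] positive. *)
have bigT (eps : R) : 0 < eps -> exists2 K : R, 0 < K & exists2 K' : R, 0 < K' &
    \forall N \near \oo, P N [set x | ~ (0 < T_stat (A N) x /\ 1 <= K' * T_stat (A N) x /\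
      energy (A N) theta x <= K * N%:R)] <= eps.
  move=> e0; have e2 : 0 < eps / 2 by rewrite divr_gt0.
  have [K K0 hK] := tight _ e2.
  have [K1 hK1] := hT _ e2.
  exists K => //; exists (Num.max K1 1); first by rewrite lt_max ltr01 orbT.
  near=> N; have N0 : (0 < N)%N by near: N; exact: nbhs_infty_gt.
  apply: (@le_trans _ _ (P N ([set x | K * N%:R < energy (A N) theta x]
     `|` [set x | K1%:E < `|T_inv (A N) x / 1|]%E))).
    apply: Pmono => x /=; apply: contra_notP.
    move=> /not_orP[/negP]; rewrite -leNgt => hE hTx.
    have [T0 T1] := inve_ratio_small (T_ge0 _ x N0) ltr01 hTx.
    rewrite mul1r in T1; split=> //; split=> //; apply: le_trans T1 _.
    by rewrite ler_wpM2r ?(ltW T0) // le_max lexx.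
  apply: le_trans (PU _ _ _) _.
  rewrite [leRHS](_ : _ = eps / 2 + eps / 2); last by field.
  by apply: lerD; [exact: hK|near: N].
have part_c1 : P N (Omega_set (A N) `&` Lambda_set N) @[N --> \oo] --> (1 : R).
  apply/cvg_to1P => // eps e0.
  have [K K0 [K' K'0 hN]] := bigT _ e0.
  have c0 := cond_prob_floor_gt0 g q0 theta; set c := cond_prob_floor g theta in c0.
  near=> N; have N0 : (0 < N)%N by near: N; exact: nbhs_infty_gt.
  have NR : 0 < N%:R :> R by rewrite ltr0n.
  set s := Num.sqrt (N%:R : R).
  have sN0 : 0 < s by rewrite sqrtr_gt0.
  have NN : N%:R = s * s by rewrite -expr2 sqr_sqrtr // ltW.
  have bad : P N [set x | ~ (0 < T_stat (A N) x /\ 1 <= K' * T_stat (A N) x /\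
      energy (A N) theta x <= K * N%:R)] <= eps by near: N.
  rewrite PC; apply: le_trans (Pmono _ _ _ _) bad.
  move=> x /=; apply: contra_not => -[T0 [T1 hE]].
  (* A missing colour would give [(c * N) ^+ 2 <= K * N], false once [N] exceeds [K / (c * c)]. *)
  have Lx : Lambda_set N x.
    apply: contrapT => nL.
    have := score_energy_lower (@A_ge0 N) (rowg N) q0 theta N0 nL.
    rewrite -/c => low.
    have : (c * N%:R) ^+ 2 <= K * N%:R.
      by apply: le_trans low _; apply: le_trans hE; rewrite lerDl gap_energy_ge0.
    have cc0 : 0 < c * c by exact: mulr_gt0.
    rewrite [leLHS](_ : _ = c * c * N%:R * N%:R); last by ring.
    rewrite ler_pM2r // -ler_pdivlMl //.
    rewrite leNgt => /negP; apply; near: N; exact: nbhs_infty_gtr.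
  split=> //; apply: contrapT => nO.
  have := T_stat_le_of_notOmega (@A_ge0 N) (rowg N) g0 q0 theta N0 Lx nO.
  set D := dichotomy_const _ _.
  have D0 : 0 <= D by exact: dichotomy_const_ge0.
  have sE : Num.sqrt (gap_energy (A N) theta x) <= Num.sqrt K * s.
    rewrite -sqrtrM ?(ltW K0) // ler_sqrt; last by rewrite mulr_ge0 // ltW.
    by apply: le_trans hE; rewrite lerDr score_energy_ge0.
  move=> hT'.
  have h1 : N%:R * T_stat (A N) x <= q%:R ^+ 2 * (D * (Num.sqrt K * s)).
    by apply: le_trans hT' _; rewrite ler_wpM2l ?sqr_ge0 // ler_wpM2l.
  (* Outside Omega, [N * T] is at most a constant times [sqrt N]; as [T] is at least [K'^-1], this
     bounds [sqrt N] and fails for large [N]. *)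
  have h2 : s <= K' * (q%:R ^+ 2 * (D * Num.sqrt K)).
    rewrite -(ler_pM2r sN0) -NN.
    apply: (@le_trans _ _ (K' * (N%:R * T_stat (A N) x))).
      by rewrite mulrCA -[leLHS]mulr1 ler_wpM2l // ltW.
    apply: le_trans (ler_wpM2l (ltW K'0) h1) _.
    by rewrite le_eqVlt; apply/orP; left; apply/eqP; ring.
  by move: h2; rewrite leNgt /s /D => /negP; apply; near: N; exact: near_sqrt_gt.
have part_c2 : P N [set x | MPL_exists (A N) x] @[N --> \oo] --> (1 : R).
  apply/cvg_to1P => // eps e0.
  apply: filterS ((cvg_to1P (fun N => P_le1 N _)).1 part_c1 _ e0) => N.
  apply: le_trans; rewrite lerD2l lerN2; apply: Pmono => x OLx.
  by apply: part_a; exact/mem_set.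
split=> // eps e0.
have e2 : 0 < eps / 2 by rewrite divr_gt0.
have [K K0 [K' K'0 hN]] := bigT _ e2.
have hM := (cvg_to1P (fun N => P_le1 N _)).1 part_c2 _ e2.
(* [local_bound] controls [sqrt N * T] times the error by [a K], and [1 <= K' * T] removes [T] at
   the cost of the factor [K']. *)
exists (a K * K'); near=> N.
have N0 : (0 < N)%N by near: N; exact: nbhs_infty_gt.
have sN0 : 0 < Num.sqrt (N%:R : R) by rewrite sqrtr_gt0 ltr0n.
apply: (@le_trans _ _ (P N ([set x | ~ (0 < T_stat (A N) x /\ 1 <= K' * T_stat (A N) x /\
      energy (A N) theta x <= K * N%:R)] `|` ~` [set x | MPL_exists (A N) x]))).
  apply: Pmono => x /= big; apply: contrapT.
  move=> /not_orP[/contrapT[T0 [T1 hE]] /contrapT hex].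
  have := ratio_inve_gt (d_ge0 _ _) sN0 big; rewrite ltNge => /negP; apply.
  have large : (g + 1) * a K * K' < Num.sqrt N%:R by near: N; exact: near_sqrt_gt.
  have sT : Num.sqrt N%:R <= Num.sqrt N%:R * T_stat (A N) x * K'.
    by rewrite -mulrA (mulrC _ K') -[leLHS]mulr1 ler_wpM2l // ltW.
  have hb : Num.sqrt N%:R * T_stat (A N) x * l2_dist (thetahat N x) theta <= a K.
    apply: (@local_bound N x K) => //.
    by rewrite -(ltr_pM2r K'0) (lt_le_trans large).
  have := ler_wpM2r (ltW K'0) hb.
  apply: le_trans; rewrite mulrC mulrAC ler_wpM2r //.
apply: le_trans (PU _ _ _) _.
rewrite [leRHS](_ : _ = eps / 2 + eps / 2); last by field.
by apply: lerD; [near: N|rewrite -PC; near: N].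
Unshelve. all: by end_near. Qed.
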